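(* Let $(\mathbb X,\mathbb T)$ and $(\mathbb X',\mathbb T')$ be two tangentads of a 2-category $\mathbf K$. If the 2-product $\mathbb X\times\mathbb X'$ of the underlying objects exists in $\mathbf K$, then $\mathbb X\times\mathbb X'$ comes equipped with a tangent structure $\mathbb T\times\mathbb T'$ and the corresponding tangentad $(\mathbb X\times\mathbb X',\mathbb T\times\mathbb T')$ is the 2-product of $(\mathbb X,\mathbb T)$ and $(\mathbb X',\mathbb T')$ in $\mathsf{Tng}(\mathbf K)$. In particular, if $\mathbf K$ admits all 2-products, so does $\mathsf{Tng}(\mathbf K)$, and they are preserved by the forgetful 2-functor $\mathsf{Tng}(\mathbf K)\to\mathbf K$. Moreover, the projections $\pi_1:(\mathbb X\times\mathbb X',\mathbb T\times\mathbb T')\to(\mathbb X,\mathbb T)$ and $\pi_2:(\mathbb X\times\mathbb X',\mathbb T\times\mathbb T')\to(\mathbb X',\mathbb T')$ are strict tangent morphisms.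
   Context: Let $\mathbf K$ be a 2-category. For a 2-morphism $\varphi$ and a 1-morphism $H$, write $H\varphi$ and $\varphi_H$ for the whiskerings (post- and precomposition with $H$). A pullback in $\mathbf K(\mathbb X,\mathbb Y)$ is pointwise if it is preserved by $\mathbf K(F,\mathbb Y)$ for every 1-morphism $F:\mathbb X'\to\mathbb X$. Tangentad: a tangentad $(\mathbb X,\mathbb T)$ in $\mathbf K$ is an object $\mathbb X$ with a tangent structure $\mathbb T=(T,p,z,s,l,c)$: a 1-morphism $T:\mathbb X\to\mathbb X$ and 2-morphisms $p:T\Rightarrow\mathrm{id}$, $z:\mathrm{id}\Rightarrow T$, $s:T_2\Rightarrow T$, $l:T\Rightarrow T^2$, $c:T^2\Rightarrow T^2$ such that: (1) for each $n\ge1$ the $n$-fold pullback $T_n$ of $p$ along itself (projections $\pi_k:T_n\Rightarrow T$) exists in $\mathbf K(\mathbb X,\mathbb X)$, is pointwise, and is preserved by postcomposition with all iterates $T^m$; (2) $pz=\mathrm{id}$, $ps=p\pi_1$, and $s$ is associative, commutative and unital with unit $z$; (3) $Tp\circ l=z\circ p$, $l\circ z=Tz\circ z$, $l\circ s=Ts\circ\langle l\pi_1,l\pi_2\rangle$; (4) $p_T\circ c=Tp$, $c\circ Tz=z_T$, $c\circ Ts=s_T\circ\langle c\circ T\pi_1,c\circ T\pi_2\rangle$; (5) $Tl\circ l=l_T\circ l$, $c\circ l=l$, $c_T\circ Tc\circ l_T=Tl\circ c$, $c\circ c=\mathrm{id}$, $Tc\circ c_T\circ Tc=c_T\circ Tc\circ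 c_T$; (6) the square with top $Ts\circ\langle l\pi_1,z_T\pi_2\rangle:T_2\Rightarrow T^2$, left side $p\pi_1:T_2\Rightarrow\mathrm{id}$, right side $Tp:T^2\Rightarrow T$ and bottom $z:\mathrm{id}\Rightarrow T$ is a pointwise pullback. Morphisms: a lax tangent morphism $(F,\alpha):(\mathbb X,\mathbb T)\to(\mathbb X',\mathbb T')$ is a 1-morphism $F:\mathbb X\to\mathbb X'$ with a 2-morphism $\alpha:F\circ T\Rightarrow T'\circ F$ such that $p'_F\circ\alpha=Fp$, $\alpha\circ Fz=z'_F$, $\alpha\circ Fs=s'_F\circ\langle\alpha\circ F\pi_1,\alpha\circ F\pi_2\rangle$, $l'_F\circ\alpha=T'\alpha\circ\alpha_T\circ Fl$, $c'_F\circ T'\alpha\circ\alpha_T=T'\alpha\circ\alpha_T\circ Fc$. It is strict if $\alpha$ is an identity. A tangent 2-morphism $\varphi:(F,\alpha)\Rightarrow(G,\beta)$ is a 2-morphism $\varphi:F\Rightarrow G$ with $T'\varphi\circ\alpha=\beta\circ\varphi_T$. $\mathsf{Tng}(\mathbf K)$ is the 2-category of tangentads of $\mathbf K$, lax tangent morphisms and tangent 2-morphisms. $\mathbb T\times\mathbb T'$ denotes the structure with tangent bundle 1-morphism $T\times T'$ and structural 2-morphisms the products of those of $\mathbb T$ and $\mathbb T'$. *)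

(* Defs.v *)
From mathcomp Require Import all_boot.
From Stdlib Require Import ProofIrrelevance.

Set Implicit Arguments.
Unset Strict Implicit.
Unset Printing Implicit Defensive.

(* [heq a b]: the 2-cells a : f => g and b : f' => g' have equal sources, equal
   targets, and are equal. It is needed because in a strict 2-category two
   parallel 1-cells such as h(gf) and (hg)f are equal but not convertible, so
   that 2-cells which are to be compared may have different Rocq types. *)
Inductive heq (A : Type) (B : A -> A -> Type) (f g : A) (a : B f g) :
  forall f' g' : A, B f' g' -> Prop := heq_refl : heq a a.

Record TwoCategory := {
  ob :> Type;
  hom : ob -> ob -> Type;
  hom2 : forall X Y : ob, hom X Y -> hom X Y -> Type;
  id1 : forall X, hom X X;
  comp1 : forall X Y Z, hom Y Z -> hom X Y -> hom X Z;
  id2 : forall X Y (f : hom X Y), hom2 f f;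
  comp2 : forall X Y (f g h : hom X Y), hom2 g h -> hom2 f g -> hom2 f h;
  lwhisker : forall X Y Z (H : hom Y Z) (f g : hom X Y),
    hom2 f g -> hom2 (comp1 H f) (comp1 H g);
  rwhisker : forall X Y Z (f g : hom Y Z) (a : hom2 f g) (H : hom X Y),
    hom2 (comp1 f H) (comp1 g H);
  comp1A : forall W X Y Z (h : hom Y Z) (g : hom X Y) (f : hom W X),
    comp1 (comp1 h g) f = comp1 h (comp1 g f);
  comp1_1f : forall X Y (f : hom X Y), comp1 (id1 Y) f = f;
  comp1_f1 : forall X Y (f : hom X Y), comp1 f (id1 X) = f;
  comp2A : forall X Y (f g h k : hom X Y)
    (c : hom2 h k) (b : hom2 g h) (a : hom2 f g),
    comp2 (comp2 c b) a = comp2 c (comp2 b a);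
  comp2_1f : forall X Y (f g : hom X Y) (a : hom2 f g), comp2 (id2 g) a = a;
  comp2_f1 : forall X Y (f g : hom X Y) (a : hom2 f g), comp2 a (id2 f) = a;
  lwhisker_id2 : forall X Y Z (H : hom Y Z) (f : hom X Y),
    lwhisker H (id2 f) = id2 (comp1 H f);
  lwhisker_comp2 : forall X Y Z (H : hom Y Z) (f g h : hom X Y)
    (b : hom2 g h) (a : hom2 f g),
    lwhisker H (comp2 b a) = comp2 (lwhisker H b) (lwhisker H a);
  rwhisker_id2 : forall X Y Z (f : hom Y Z) (H : hom X Y),
    rwhisker (id2 f) H = id2 (comp1 f H);
  rwhisker_comp2 : forall X Y Z (f g h : hom Y Z)
    (b : hom2 g h) (a : hom2 f g) (H : hom X Y),
    rwhisker (comp2 b a) H = comp2 (rwhisker b H) (rwhisker a H);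
  interchange : forall X Y Z (f f' : hom X Y) (g g' : hom Y Z)
    (b : hom2 g g') (a : hom2 f f'),
    comp2 (rwhisker b f') (lwhisker g a) = comp2 (lwhisker g' a) (rwhisker b f);
  lwhisker1 : forall X Y (f g : hom X Y) (a : hom2 f g),
    heq (lwhisker (id1 Y) a) a;
  rwhisker1 : forall X Y (f g : hom X Y) (a : hom2 f g),
    heq (rwhisker a (id1 X)) a;
  lwhiskerA : forall W X Y Z (H : hom Y Z) (G : hom X Y) (f g : hom W X)
    (a : hom2 f g), heq (lwhisker (comp1 H G) a) (lwhisker H (lwhisker G a));
  rwhiskerA : forall W X Y Z (f g : hom Y Z) (a : hom2 f g)
    (G : hom X Y) (H : hom W X),
    heq (rwhisker (rwhisker a G) H) (rwhisker a (comp1 G H));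
  lrwhiskerA : forall W X Y Z (H : hom Y Z) (f g : hom X Y) (a : hom2 f g)
    (G : hom W X), heq (rwhisker (lwhisker H a) G) (lwhisker H (rwhisker a G)) }.

Arguments hom {t} _ _.
Arguments hom2 {t X Y} _ _.
Arguments id1 {t} X.
Arguments comp1 {t X Y Z} _ _.
Arguments id2 {t X Y} f.
Arguments comp2 {t X Y f g h} _ _.
Arguments lwhisker {t X Y Z} H {f g} _.
Arguments rwhisker {t X Y Z f g} _ H.

Declare Scope twocat_scope.
Delimit Scope twocat_scope with C.
Local Open Scope twocat_scope.

Notation "g ∘ f" := (comp1 g f) (at level 40, left associativity) : twocat_scope.
Notation "b • a" := (comp2 b a) (at level 45, right associativity) : twocat_scope.
Notation "H ◁ a" := (lwhisker H a) (at level 43, right associativity) : twocat_scope.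
Notation "a ▷ H" := (rwhisker a H) (at level 42, left associativity) : twocat_scope.
Notation "a ≡ b" := (heq a b) (at level 70, no associativity) : twocat_scope.

Definition eq2 (K : TwoCategory) (X Y : K) (f g : hom X Y) (e : f = g) :
  hom2 f g := match e with erefl => id2 f end.

(* Vertical composition of 2-cells that are composable only up to an equality of
   1-cells; in the notation [b ⊙ a] the equality is found by associativity and
   unitality of the composition of 1-cells. *)
Definition comp2e (K : TwoCategory) (X Y : K) (f g g' h : hom X Y)
  (b : hom2 g' h) (a : hom2 f g) (e : g = g') : hom2 f h := b • eq2 e • a.

Ltac strictness := rewrite ?comp1A ?comp1_1f ?comp1_f1; reflexivity.

Notation "b ⊙ a" := (comp2e b a ltac:(strictness))
  (at level 45, right associativity, only parsing) : twocat_scope.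

Definition cast2 (K : TwoCategory) (X Y : K) (f g f' g' : hom X Y)
  (ef : f = f') (eg : g = g') (a : hom2 f g) : hom2 f' g' :=
  match ef in _ = f1, eg in _ = g1 return hom2 f1 g1 with
  | erefl, erefl => a
  end.

Section Pullbacks.
Variables (K : TwoCategory) (X Y : K).

(* For n >= 1; the index k : 'I_n of a projection counts from 0. *)
Definition IsFibrePower (f g : hom X Y) (p : hom2 f g) (n : nat)
  (A : hom X Y) (q : 'I_n -> hom2 A f) : Prop :=
  (forall i j, p • q i = p • q j) /\
  (forall (B : hom X Y) (b : 'I_n -> hom2 B f),
     (forall i j, p • b i = p • b j) ->
     exists! u : hom2 B A, forall i, q i • u = b i).

Definition IsPullback (A B C P : hom X Y) (f : hom2 A C) (g : hom2 B C)
  (p1 : hom2 P A) (p2 : hom2 P B) : Prop :=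
  f • p1 = g • p2 /\
  (forall (Q : hom X Y) (q1 : hom2 Q A) (q2 : hom2 Q B), f • q1 = g • q2 ->
     exists! u : hom2 Q P, p1 • u = q1 /\ p2 • u = q2).

(* u = <a, b>, the 2-cell induced by a and b into an object with two
   projections q. *)
Definition IsPairing (A B C : hom X Y) (q : 'I_2 -> hom2 A C)
  (a b : hom2 B C) (u : hom2 B A) : Prop :=
  q ord0 • u = a /\ q ord_max • u = b.

End Pullbacks.

Definition IsPointwiseFibrePower (K : TwoCategory) (X Y : K) (f g : hom X Y)
  (p : hom2 f g) (n : nat) (A : hom X Y) (q : 'I_n -> hom2 A f) : Prop :=
  IsFibrePower p q /\
  (forall (X' : K) (F : hom X' X), IsFibrePower (p ▷ F) (fun i => q i ▷ F)).

Definition IsPointwisePullback (K : TwoCategory) (X Y : K)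
  (A B C P : hom X Y) (f : hom2 A C) (g : hom2 B C)
  (p1 : hom2 P A) (p2 : hom2 P B) : Prop :=
  IsPullback f g p1 p2 /\
  (forall (X' : K) (F : hom X' X),
     IsPullback (f ▷ F) (g ▷ F) (p1 ▷ F) (p2 ▷ F)).

Fixpoint iter1 (K : TwoCategory) (X : K) (T : hom X X) (m : nat) : hom X X :=
  if m is m'.+1 then T ∘ iter1 T m' else id1 X.

(* The pullback T_2, being the source of s, is part of the data; the other
   pullbacks T_n are only required to exist. *)
Record TangentData (K : TwoCategory) (X : K) := {
  tT : hom X X;
  tT2 : hom X X;
  tpr : 'I_2 -> hom2 tT2 tT;
  tp : hom2 tT (id1 X);
  tz : hom2 (id1 X) tT;
  ts : hom2 tT2 tT;
  tl : hom2 tT (tT ∘ tT);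
  tc : hom2 (tT ∘ tT) (tT ∘ tT) }.

Definition IsTangentPower (K : TwoCategory) (X : K) (T : hom X X)
  (p : hom2 T (id1 X)) (n : nat) (Tn : hom X X) (q : 'I_n -> hom2 Tn T) : Prop :=
  IsPointwiseFibrePower p q /\
  (forall m, IsFibrePower (iter1 T m ◁ p) (fun i => iter1 T m ◁ q i)).

Section TangentAxioms.
Variables (K : TwoCategory) (X : K) (D : TangentData X).
Let T := tT D.
Let T2 := tT2 D.
Let pr := tpr D.
Let p := tp D.
Let z := tz D.
Let s := ts D.
Let l := tl D.
Let c := tc D.

(* Each induced 2-cell <a, b> is introduced by an existential quantifier; it is
   unique by the universal property of the pullback in question. *)
Record IsTangentStructure : Prop := {
  tangent_power2 : IsTangentPower p pr;
  tangent_power : forall n, (1 <= n)%N ->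
    exists (Tn : hom X X) (q : 'I_n -> hom2 Tn T), IsTangentPower p q;

  tangent_pz : p • z = id2 (id1 X);
  tangent_ps : p • s = p • pr ord0;
  tangent_sA : forall (T3 : hom X X) (q : 'I_3 -> hom2 T3 T),
    IsFibrePower p q ->
    let q1 := q ord0 in let q2 := q (@Ordinal 3 1 isT) in let q3 := q ord_max in
    exists u12 u23 v w,
      [/\ IsPairing pr q1 q2 u12, IsPairing pr q2 q3 u23,
          IsPairing pr (s • u12) q3 v, IsPairing pr q1 (s • u23) w
        & s • v = s • w];
  tangent_sC : exists2 u, IsPairing pr (pr ord_max) (pr ord0) u & s • u = s;
  tangent_s1 : exists2 u, IsPairing pr (z • p) (id2 T) u & s • u = id2 T;

  tangent_Tpl : (T ◁ p) • l ≡ z • p;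
  tangent_lz : l • z ≡ (T ◁ z) ⊙ z;
  tangent_ls :
    exists2 u, IsPairing (fun i => T ◁ pr i) (l • pr ord0) (l • pr ord_max) u
             & l • s = (T ◁ s) • u;

  tangent_pTc : (p ▷ T) • c ≡ T ◁ p;
  tangent_cTz : c • (T ◁ z) ≡ z ▷ T;
  tangent_cTs :
    exists2 u, IsPairing (fun i => pr i ▷ T)
                 (c • (T ◁ pr ord0)) (c • (T ◁ pr ord_max)) u
             & c • (T ◁ s) = (s ▷ T) • u;

  tangent_Tll : (T ◁ l) • l ≡ (l ▷ T) • l;
  tangent_cl : c • l = l;
  tangent_cTcl : (c ▷ T) ⊙ (T ◁ c) ⊙ (l ▷ T) ≡ (T ◁ l) • c;
  tangent_cc : c • c = id2 (T ∘ T);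
  tangent_ccc :
    (T ◁ c) ⊙ (c ▷ T) ⊙ (T ◁ c) ≡ (c ▷ T) ⊙ (T ◁ c) ⊙ (c ▷ T);

  tangent_vertical_lift :
    exists2 u, IsPairing (fun i => T ◁ pr i)
                 (l • pr ord0) ((z ▷ T) ⊙ pr ord_max) u
             & IsPointwisePullback (eq2 (comp1_f1 T) • (T ◁ p)) z
                 ((T ◁ s) • u) (p • pr ord0) }.

End TangentAxioms.

Record Tangentad (K : TwoCategory) := {
  carrier :> ob K;
  tdata :> TangentData carrier;
  taxioms : IsTangentStructure tdata }.

Section LaxAxioms.
Variables (K : TwoCategory) (X X' : K).
Variables (D : TangentData X) (D' : TangentData X').
Let T := tT D.
Let T' := tT D'.

Record IsLaxTangent (F : hom X X') (a : hom2 (F ∘ T) (T' ∘ F)) : Prop := {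
  lax_p : (tp D' ▷ F) • a ≡ F ◁ tp D;
  lax_z : a • (F ◁ tz D) ≡ tz D' ▷ F;
  lax_s :
    exists2 u, IsPairing (fun i => tpr D' i ▷ F)
                 (a • (F ◁ tpr D ord0)) (a • (F ◁ tpr D ord_max)) u
             & a • (F ◁ ts D) = (ts D' ▷ F) • u;
  lax_l : (tl D' ▷ F) • a ≡ (T' ◁ a) ⊙ (a ▷ T) ⊙ (F ◁ tl D);
  lax_c : (tc D' ▷ F) ⊙ (T' ◁ a) ⊙ (a ▷ T) ≡ (T' ◁ a) ⊙ (a ▷ T) ⊙ (F ◁ tc D) }.

End LaxAxioms.

Record LaxMorphism (K : TwoCategory) (X X' : Tangentad K) := {
  lax1 :> hom X X';
  lax2 : hom2 (lax1 ∘ tT X) (tT X' ∘ lax1);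
  lax_axioms : IsLaxTangent lax2 }.

Definition IsStrictTangent (K : TwoCategory) (X X' : Tangentad K)
  (F : LaxMorphism X X') : Prop := lax2 F ≡ id2 (F ∘ tT X).

Record TangentTwoCell (K : TwoCategory) (X X' : Tangentad K)
  (F G : LaxMorphism X X') := {
  cell :> hom2 (lax1 F) (lax1 G);
  cell_axiom : (tT X' ◁ cell) • lax2 F = lax2 G • (cell ▷ tT X) }.

Lemma heq_sym (A : Type) (B : A -> A -> Type) (f g f' g' : A)
  (a : B f g) (b : B f' g') : heq a b -> heq b a.
Proof. by case. Qed.

Lemma heq_trans (A : Type) (B : A -> A -> Type) (f g f' g' f'' g'' : A)
  (a : B f g) (b : B f' g') (c : B f'' g'') : heq a b -> heq b c -> heq a c.
Proof. by move=> []. Qed.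

Section Strictness.
Variable K : TwoCategory.
Implicit Types X Y Z : K.

Lemma heq_cast2P X Y (f g f' g' : hom X Y) (a : hom2 f g) (b : hom2 f' g') :
  a ≡ b -> exists (ef : f = f') (eg : g = g'), b = cast2 ef eg a.
Proof.
by case; exists erefl, erefl.
Qed.

Lemma cast2_heq X Y (f g f' g' : hom X Y) (ef : f = f') (eg : g = g')
  (a : hom2 f g) : cast2 ef eg a ≡ a.
Proof. by case: f' / ef; case: g' / eg. Qed.

Lemma heq_eq X Y (f g : hom X Y) (a b : hom2 f g) : a ≡ b -> a = b.
Proof.
case/heq_cast2P=> ef [eg ->].
by rewrite (proof_irrelevance _ ef erefl) (proof_irrelevance _ eg erefl).
Qed.

Lemma comp2_heq X Y (f g h f' g' h' : hom X Y)
  (b : hom2 g h) (a : hom2 f g) (b' : hom2 g' h') (a' : hom2 f' g') :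
  b ≡ b' -> a ≡ a' -> b • a ≡ b' • a'.
Proof.
case/heq_cast2P=> eg [eh ->]; case/heq_cast2P=> ef [eg' ->] {b' a'}.
case: g' / eg eg' => eg'; case: h' / eh; case: f' / ef; by rewrite (proof_irrelevance _ eg' erefl).
Qed.

Lemma comp2e_comp2 X Y (f g g1 h f' g' h' : hom X Y) (e : g = g1)
  (b : hom2 g1 h) (a : hom2 f g) (b' : hom2 g' h') (a' : hom2 f' g') :
  b ≡ b' -> a ≡ a' -> comp2e b a e ≡ b' • a'.
Proof. by case: g1 / e b => b hb ha; rewrite /comp2e comp2_1f; apply: comp2_heq. Qed.

Lemma comp2eA X Y (f g g' h h' k : hom X Y) (e : g = g') (e' : h = h')
  (c : hom2 h' k) (b : hom2 g' h) (a : hom2 f g) :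
  comp2e c (comp2e b a e) e' = comp2e (comp2e c b e') a e.
Proof. by rewrite /comp2e !comp2A. Qed.

Lemma lwhisker_comp2e X Y Z (H : hom Y Z) (f g g' h : hom X Y) (e : g = g')
  (b : hom2 g' h) (a : hom2 f g) :
  H ◁ comp2e b a e = comp2e (H ◁ b) (H ◁ a) (f_equal (comp1 H) e).
Proof. by case: g' / e b => b; rewrite /comp2e /= !comp2_1f lwhisker_comp2. Qed.

Lemma rwhisker_comp2e X Y Z (f g g' h : hom Y Z) (e : g = g')
  (b : hom2 g' h) (a : hom2 f g) (H : hom X Y) :
  comp2e b a e ▷ H = comp2e (b ▷ H) (a ▷ H) (f_equal (comp1^~ H) e).
Proof. by case: g' / e b => b; rewrite /comp2e /= !comp2_1f rwhisker_comp2. Qed.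

Lemma comp2e_heq X Y (f g g1 h f' g' g1' h' : hom X Y) (e : g = g1)
  (e' : g' = g1') (b : hom2 g1 h) (a : hom2 f g) (b' : hom2 g1' h')
  (a' : hom2 f' g') : b ≡ b' -> a ≡ a' -> comp2e b a e ≡ comp2e b' a' e'.
Proof.
case: g1' / e' b' => b' hb ha; rewrite /(comp2e b') comp2_1f.
exact: comp2e_comp2.
Qed.

Lemma lwhisker_heq X Y Z (H H' : hom Y Z) (f g f' g' : hom X Y)
  (a : hom2 f g) (a' : hom2 f' g') : H = H' -> a ≡ a' -> H ◁ a ≡ H' ◁ a'.
Proof. by move=> -> []. Qed.

Lemma rwhisker_heq X Y Z (H H' : hom X Y) (f g f' g' : hom Y Z)
  (a : hom2 f g) (a' : hom2 f' g') : H = H' -> a ≡ a' -> a ▷ H ≡ a' ▷ H'.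
Proof. by move=> -> []. Qed.

(* A 2-cell a : U => V evaluated at a generalized point g, when U ∘ g and V ∘ g
   are rewritten as u and v. *)
Definition at_pt X Y Z (U V : hom Y Z) (a : hom2 U V) (g : hom X Y)
  (u v : hom X Z) (eu : U ∘ g = u) (ev : V ∘ g = v) : hom2 u v :=
  cast2 eu ev (a ▷ g).

Lemma at_pt_heq X Y Z (U V : hom Y Z) (a : hom2 U V) (g : hom X Y) u v
  (eu : U ∘ g = u) (ev : V ∘ g = v) : at_pt a eu ev ≡ a ▷ g.
Proof. exact: cast2_heq. Qed.

End Strictness.

Section Evaluation.
Variables (K : TwoCategory).

Section Data.
Variables (X : K) (D : TangentData X) (W : K) (g : hom W X).
Definition p_at : hom2 (tT D ∘ g) g := at_pt (tp D) erefl (comp1_1f g).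
Definition z_at : hom2 g (tT D ∘ g) := at_pt (tz D) (comp1_1f g) erefl.
Definition l_at : hom2 (tT D ∘ g) (tT D ∘ (tT D ∘ g)) :=
  at_pt (tl D) erefl (comp1A _ _ _).
Definition c_at : hom2 (tT D ∘ (tT D ∘ g)) (tT D ∘ (tT D ∘ g)) :=
  at_pt (tc D) (comp1A _ _ _) (comp1A _ _ _).
End Data.

Section Lax.
Variables (X X' : K) (D : TangentData X) (D' : TangentData X').
Let T := tT D.
Let T' := tT D'.
Variables (F : hom X X') (a : hom2 (F ∘ T) (T' ∘ F)).

Definition lax_at (W : K) (g : hom W X) : hom2 (F ∘ (T ∘ g)) (T' ∘ (F ∘ g)) :=
  at_pt a (comp1A _ _ _) (comp1A _ _ _).

Lemma lax_at_heq (W : K) (g : hom W X) : lax_at g ≡ a ▷ g.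
Proof. exact: at_pt_heq. Qed.

Record LaxAt (W : K) (g : hom W X) : Prop := {
  p_lax_at : p_at D' (F ∘ g) • lax_at g = F ◁ p_at D g;
  z_lax_at : lax_at g • (F ◁ z_at D g) = z_at D' (F ∘ g);
  s_lax_at : exists2 u : hom2 (F ∘ (tT2 D ∘ g)) (tT2 D' ∘ (F ∘ g)),
      IsPairing (fun i => tpr D' i ▷ (F ∘ g))
        (lax_at g • (F ◁ (tpr D ord0 ▷ g)))
        (lax_at g • (F ◁ (tpr D ord_max ▷ g))) u
    & lax_at g • (F ◁ (ts D ▷ g)) = (ts D' ▷ (F ∘ g)) • u;
  l_lax_at : l_at D' (F ∘ g) • lax_at g =
    (T' ◁ lax_at g) • lax_at (T ∘ g) • (F ◁ l_at D g);
  c_lax_at : c_at D' (F ∘ g) • (T' ◁ lax_at g) • lax_at (T ∘ g) =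
    (T' ◁ lax_at g) • lax_at (T ∘ g) • (F ◁ c_at D g) }.

Lemma lax_at_lwhisker (W : K) (g g' : hom W X) (b : hom2 g g') :
  lax_at g' • (F ◁ (T ◁ b)) = (T' ◁ (F ◁ b)) • lax_at g.
Proof.
apply: heq_eq.
apply: heq_trans (comp2_heq (lax_at_heq _) (heq_sym (lwhiskerA _ _ _))) _.
rewrite interchange; apply: comp2_heq; first exact: lwhiskerA.
exact/heq_sym/lax_at_heq.
Qed.

Lemma laxAt (W : K) (g : hom W X) : IsLaxTangent a -> LaxAt g.
Proof.
have Fg (U V : hom X' X') (b : hom2 U V) u v (eu : U ∘ (F ∘ g) = u)
    (ev : V ∘ (F ∘ g) = v) : at_pt b eu ev ≡ b ▷ F ▷ g.
  exact: heq_trans (at_pt_heq _ _ _) (heq_sym (rwhiskerA _ _ _)).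
have Fl (U V : hom X X) (b : hom2 U V) u v (eu : U ∘ g = u)
    (ev : V ∘ g = v) : F ◁ at_pt b eu ev ≡ (F ◁ b) ▷ g.
  apply: heq_trans (heq_sym (lrwhiskerA _ _ _)).
  exact/lwhisker_heq/at_pt_heq.
have Ta : T' ◁ lax_at g ≡ (T' ◁ a) ▷ g.
  apply: heq_trans (heq_sym (lrwhiskerA _ _ _)).
  exact/lwhisker_heq/at_pt_heq.
have aT : lax_at (T ∘ g) ≡ a ▷ T ▷ g.
  exact: heq_trans (at_pt_heq _ _ _) (heq_sym (rwhiskerA _ _ _)).
case=> Hp Hz [u [u0 u1] us] Hl Hc; split.
- apply: heq_eq; apply: heq_trans (comp2_heq (Fg _ _ _ _ _ _ _) (lax_at_heq g)) _.
  rewrite -rwhisker_comp2; apply: heq_trans (heq_sym (Fl _ _ _ _ _ _ _)).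
  exact: rwhisker_heq.
- apply: heq_eq; apply: heq_trans (comp2_heq (lax_at_heq g) (Fl _ _ _ _ _ _ _)) _.
  rewrite -rwhisker_comp2; apply: heq_trans (heq_sym (Fg _ _ _ _ _ _ _)).
  exact: rwhisker_heq.
- exists (at_pt u (comp1A _ _ _) (comp1A _ _ _)).
  + have E i : tpr D' i ▷ F • u = a • (F ◁ tpr D i) ->
      tpr D' i ▷ (F ∘ g) • at_pt u (comp1A _ _ _) (comp1A _ _ _) =
      lax_at g • (F ◁ (tpr D i ▷ g)).
      move=> Ei; apply: heq_eq.
      apply: heq_trans (comp2_heq (heq_sym (rwhiskerA _ _ _)) (at_pt_heq _ _ _)) _.
      rewrite -rwhisker_comp2 Ei rwhisker_comp2.
      apply: comp2_heq; [exact/heq_sym/lax_at_heq | exact: lrwhiskerA].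
    by split; apply: E.
  + apply: heq_eq; apply: heq_sym.
    apply: heq_trans (comp2_heq (heq_sym (rwhiskerA _ _ _)) (at_pt_heq _ _ _)) _.
    rewrite -rwhisker_comp2 -us rwhisker_comp2.
    apply: comp2_heq; [exact/heq_sym/lax_at_heq | exact: lrwhiskerA].
- apply: heq_eq; apply: heq_trans (comp2_heq (Fg _ _ _ _ _ _ _) (lax_at_heq g)) _.
  rewrite -rwhisker_comp2; apply: heq_trans (rwhisker_heq erefl Hl) _.
  rewrite !rwhisker_comp2e.
  by apply: comp2e_comp2 (heq_sym Ta) (comp2e_comp2 _ (heq_sym aT) _);
    exact/heq_sym/Fl.
- apply: heq_eq.
  move/(rwhisker_heq (erefl g)): Hc; rewrite !rwhisker_comp2e => Hc.
  apply: heq_trans (heq_trans _ (heq_trans Hc _)) _; last first.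
  + exact: heq_refl.
  + apply: comp2e_comp2 (heq_sym Ta) (comp2e_comp2 _ (heq_sym aT) _).
    exact/heq_sym/Fl.
  apply: heq_sym; apply: comp2e_comp2; first exact/heq_sym/Fg.
  exact: comp2e_comp2 (heq_sym Ta) (heq_sym aT).
Qed.

Lemma isLax_at : LaxAt (id1 X) -> IsLaxTangent a.
Proof.
have Fg (U V : hom X' X') (b : hom2 U V) u v (eu : U ∘ (F ∘ id1 X) = u)
    (ev : V ∘ (F ∘ id1 X) = v) : b ▷ F ≡ at_pt b eu ev.
  apply: heq_sym; apply: heq_trans (at_pt_heq _ _ _) _.
  by apply: rwhisker_heq => //; rewrite comp1_f1.
have Fl (U V : hom X X) (b : hom2 U V) u v (eu : U ∘ id1 X = u)
    (ev : V ∘ id1 X = v) : F ◁ b ≡ F ◁ at_pt b eu ev.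
  apply: heq_sym; apply/lwhisker_heq => //.
  exact: heq_trans (at_pt_heq _ _ _) (rwhisker1 _).
have a1 : a ≡ lax_at (id1 X).
  exact/heq_sym/(heq_trans (lax_at_heq _))/rwhisker1.
have Ta : T' ◁ a ≡ T' ◁ lax_at (id1 X) by exact: lwhisker_heq.
have aT : a ▷ T ≡ lax_at (T ∘ id1 X).
  apply/heq_sym/(heq_trans (lax_at_heq _)).
  by apply: rwhisker_heq => //; rewrite comp1_f1.
case=> Hp Hz [u [u0 u1] us] Hl Hc; split.
- apply: heq_trans (comp2_heq (b' := p_at D' _) (Fg _ _ _ _ _ _ _) a1) _.
  by rewrite Hp; exact/heq_sym/Fl.
- apply: heq_trans (comp2_heq (a' := F ◁ z_at D _) a1 (Fl _ _ _ _ _ _ _)) _.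
  by rewrite Hz; exact/heq_sym/Fg.
- have e0 : F ∘ (tT2 D ∘ id1 X) = F ∘ tT2 D by rewrite comp1_f1.
  have e1 : tT2 D' ∘ (F ∘ id1 X) = tT2 D' ∘ F by rewrite comp1_f1.
  have E (r' : hom2 (tT2 D') T') (r : hom2 (tT2 D) T) :
     (r' ▷ (F ∘ id1 X)) • u = lax_at (id1 X) • (F ◁ (r ▷ id1 X)) ->
     (r' ▷ F) • cast2 e0 e1 u = a • (F ◁ r).
    move=> E; apply: heq_eq.
    apply: (heq_trans (comp2_heq (b' := r' ▷ (F ∘ id1 X)) (a' := u) _ _)).
    - by apply: rwhisker_heq => //; rewrite comp1_f1.
    - exact: cast2_heq.
    rewrite E; apply/heq_sym/comp2_heq => //.
    by apply: lwhisker_heq => //; exact/heq_sym/rwhisker1.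
  by exists (cast2 e0 e1 u); [split; apply: E | rewrite (E (ts D') (ts D))].
- apply: heq_trans (comp2_heq (b' := l_at D' _) (Fg _ _ _ _ _ _ _) a1) _.
  rewrite Hl; apply: heq_sym.
  by do 2?[apply: comp2e_comp2 => //]; apply: Fl.
- apply: (@heq_trans _ _ _ _ _ _ _ _ _
    (c_at D' (F ∘ id1 X) • (T' ◁ lax_at (id1 X)) • lax_at (T ∘ id1 X))).
    by do 2?[apply: comp2e_comp2 => //]; apply: Fg.
  by rewrite Hc; apply: heq_sym; do 2?[apply: comp2e_comp2 => //]; apply: Fl.
Qed.

End Lax.
End Evaluation.

Section TangentTwoCategory.
Variable K : TwoCategory.
Implicit Types X Y Z W : Tangentad K.

Lemma lax_morphism_eq X Y (F G : LaxMorphism X Y) :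
  lax1 F = lax1 G -> lax2 F ≡ lax2 G -> F = G.
Proof.
case: F G => F a aP [G b bP] /= e; case: G / e b bP => b bP /heq_eq e.
by case: b / e bP => bP; rewrite (proof_irrelevance _ aP bP).
Qed.

Lemma tangent_cell_eq X Y (F G : LaxMorphism X Y) (a b : TangentTwoCell F G) :
  cell a = cell b -> a = b.
Proof.
case: a b => a aP [b bP] /= e; case: b / e bP => bP.
by rewrite (proof_irrelevance _ aP bP).
Qed.

Lemma tangent_cell_heq X Y (F G F' G' : LaxMorphism X Y)
  (a : TangentTwoCell F G) (b : TangentTwoCell F' G') :
  F = F' -> G = G' -> cell a ≡ cell b -> heq a b.
Proof.
move=> eF eG; case: F' / eF b; case: G' / eG => b /heq_eq/tangent_cell_eq ->.
exact: heq_refl.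
Qed.

Definition lax_id2 X : hom2 (id1 X ∘ tT X) (tT X ∘ id1 X) :=
  cast2 (esym (comp1_1f _)) (esym (comp1_f1 _)) (id2 (tT X)).

Lemma p_at_heq X (A : K) (g g' : hom A X) : g = g' -> p_at X g ≡ p_at X g'.
Proof. by move=> ->. Qed.
Lemma z_at_heq X (A : K) (g g' : hom A X) : g = g' -> z_at X g ≡ z_at X g'.
Proof. by move=> ->. Qed.
Lemma l_at_heq X (A : K) (g g' : hom A X) : g = g' -> l_at X g ≡ l_at X g'.
Proof. by move=> ->. Qed.
Lemma c_at_heq X (A : K) (g g' : hom A X) : g = g' -> c_at X g ≡ c_at X g'.
Proof. by move=> ->. Qed.

Lemma lax_id_at X (A : K) (g : hom A X) : lax_at (lax_id2 X) g ≡ id2 (tT X ∘ g).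
Proof.
apply: heq_trans (lax_at_heq _ _) _; rewrite -rwhisker_id2.
by apply: rwhisker_heq => //; exact: cast2_heq.
Qed.

Lemma lax_id_axioms X : IsLaxTangent (lax_id2 X).
Proof.
apply: isLax_at; set g := id1 X.
have Tid : tT X ◁ lax_at (lax_id2 X) g ≡ id2 (tT X ∘ (tT X ∘ g)).
  by rewrite -lwhisker_id2; apply: lwhisker_heq => //; apply: lax_id_at.
split.
- apply: heq_eq.
  apply: heq_trans (comp2_heq (p_at_heq (comp1_1f g)) (lax_id_at g)) _.
  by rewrite comp2_f1; exact/heq_sym/lwhisker1.
- apply: heq_eq.
  apply: heq_trans (comp2_heq (lax_id_at g) (lwhisker1 _)) _.
  by rewrite comp2_1f; exact/heq_sym/z_at_heq/comp1_1f.
- have e0 : tT2 X ∘ g = id1 X ∘ (tT2 X ∘ g) by rewrite comp1_1f.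
  have e1 : tT2 X ∘ g = tT2 X ∘ (id1 X ∘ g) by rewrite comp1_1f.
  have E (r : hom2 (tT2 X) (tT X)) :
    (r ▷ (id1 X ∘ g)) • cast2 e0 e1 (id2 _) =
    lax_at (lax_id2 X) g • (id1 X ◁ (r ▷ g)).
    apply: heq_eq; apply: (@heq_trans _ _ _ _ _ _ _ _ _ (r ▷ g)).
      rewrite -[r ▷ g]comp2_f1; apply: comp2_heq (cast2_heq _ _ _).
      by apply: rwhisker_heq => //; rewrite comp1_1f.
    rewrite -[r ▷ g]comp2_1f; apply/heq_sym/comp2_heq; first exact: lax_id_at.
    by rewrite comp2_1f; apply: lwhisker1.
  by exists (cast2 e0 e1 (id2 _)) => //; split; rewrite E.
- apply: heq_eq.
  apply: heq_trans (comp2_heq (l_at_heq (comp1_1f g)) (lax_id_at g)) _.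
  apply: heq_sym.
  apply: heq_trans (comp2_heq Tid (comp2_heq (lax_id_at _) (lwhisker1 _))) _.
  by rewrite !comp2_1f comp2_f1; exact: heq_refl.
- apply: heq_eq.
  apply: heq_trans
    (comp2_heq (c_at_heq (comp1_1f g)) (comp2_heq Tid (lax_id_at _))) _.
  apply: heq_sym.
  apply: heq_trans (comp2_heq Tid (comp2_heq (lax_id_at _) (lwhisker1 _))) _.
  by rewrite !comp2_1f !comp2_f1; exact: heq_refl.
Qed.

Definition lax_id X : LaxMorphism X X :=
  {| lax1 := id1 X; lax2 := lax_id2 X; lax_axioms := lax_id_axioms X |}.

Section Composition.
Variables (X Y Z : Tangentad K) (G : LaxMorphism Y Z) (F : LaxMorphism X Y).

Definition lax_comp2 : hom2 ((lax1 G ∘ lax1 F) ∘ tT X) (tT Z ∘ (lax1 G ∘ lax1 F)) :=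
  cast2 (esym (comp1A _ _ _)) (comp1A _ _ _)
    ((lax2 G ▷ lax1 F) ⊙ (lax1 G ◁ lax2 F)).

Lemma lax_comp2E : lax_comp2 ≡ lax_at (lax2 G) F • (lax1 G ◁ lax2 F).
Proof.
apply: heq_trans (cast2_heq _ _ _) _.
by apply: comp2e_comp2; [exact/heq_sym/lax_at_heq | exact: heq_refl].
Qed.

Lemma lax_comp_at (A : K) (g : hom A X) : lax_at lax_comp2 g ≡
  lax_at (lax2 G) (lax1 F ∘ g) • (lax1 G ◁ lax_at (lax2 F) g).
Proof.
apply: heq_trans (lax_at_heq _ _) _.
apply: heq_trans (rwhisker_heq erefl (cast2_heq _ _ _)) _.
rewrite rwhisker_comp2e; apply: comp2e_comp2.
  exact: heq_trans (rwhiskerA _ _ _) (heq_sym (lax_at_heq _ _)).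
apply: heq_trans (lrwhiskerA _ _ _) _.
exact/lwhisker_heq/heq_sym/lax_at_heq.
Qed.

Lemma lax_comp_axioms : IsLaxTangent lax_comp2.
Proof.
apply: isLax_at; set g := id1 X.
have [Fp Fz [u [u0 u1] us] Fl Fc] := laxAt g (lax_axioms F).
have [Gp Gz [v [v0 v1] vs] Gl Gc] := laxAt (lax1 F ∘ g) (lax_axioms G).
have eg : (lax1 G ∘ lax1 F) ∘ g = lax1 G ∘ (lax1 F ∘ g) := comp1A _ _ _.
have nat_G (h : hom X Z) (b : hom2 h (lax1 G ∘ (lax1 F ∘ (tT X ∘ (tT X ∘ g))))) :
    lax_at (lax2 G) _ • (lax1 G ◁ (tT Y ◁ lax_at (lax2 F) g)) • (lax1 G ◁ lax_at (lax2 F) (tT X ∘ g)) • b =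
    (tT Z ◁ (lax1 G ◁ lax_at (lax2 F) g)) • lax_at (lax2 G) _ • (lax1 G ◁ lax_at (lax2 F) (tT X ∘ g)) • b.
  by rewrite -comp2A lax_at_lwhisker comp2A.
have Tat (h : hom X X) : tT Z ◁ lax_at lax_comp2 h ≡
    (tT Z ◁ lax_at (lax2 G) (lax1 F ∘ h)) • (tT Z ◁ (lax1 G ◁ lax_at (lax2 F) h)).
  by rewrite -lwhisker_comp2; apply: lwhisker_heq => //; apply: lax_comp_at.
split.
- apply: heq_eq; apply: heq_trans (comp2_heq (p_at_heq eg) (lax_comp_at g)) _.
  rewrite -comp2A Gp -lwhisker_comp2 Fp.
  exact/heq_sym/lwhiskerA.
- apply: heq_eq; apply: heq_trans (comp2_heq (lax_comp_at g) (lwhiskerA _ _ _)) _.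
  rewrite comp2A -lwhisker_comp2 Fz Gz.
  exact/heq_sym/z_at_heq.
- pose w := cast2 (esym (comp1A _ _ _)) (f_equal (comp1 (tT2 Z)) (esym eg))
              (v • (lax1 G ◁ u)).
  have E (r'' : hom2 (tT2 Z) (tT Z)) (r' : hom2 (tT2 Y) (tT Y))
      (r : hom2 (tT2 X) (tT X)) :
    (r' ▷ (lax1 F ∘ g)) • u = lax_at (lax2 F) g • (lax1 F ◁ (r ▷ g)) ->
    (r'' ▷ (lax1 G ∘ (lax1 F ∘ g))) • v =
      lax_at (lax2 G) (lax1 F ∘ g) • (lax1 G ◁ (r' ▷ (lax1 F ∘ g))) ->
    (r'' ▷ (lax1 G ∘ lax1 F ∘ g)) • w =
      lax_at lax_comp2 g • ((lax1 G ∘ lax1 F) ◁ (r ▷ g)).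
    move=> Eu Ev; apply: heq_eq.
    apply: heq_trans (comp2_heq (rwhisker_heq eg (heq_refl _)) (cast2_heq _ _ _)) _.
    rewrite -comp2A Ev comp2A -lwhisker_comp2 Eu lwhisker_comp2 -comp2A.
    exact/heq_sym/comp2_heq/lwhiskerA/lax_comp_at.
  exists w; first by split; [exact: E u0 v0 | exact: E u1 v1].
  by rewrite (E (ts Z) (ts Y) (ts X)).
- apply: heq_eq; apply: heq_trans (comp2_heq (l_at_heq eg) (lax_comp_at g)) _.
  apply: heq_sym; apply: heq_trans
    (comp2_heq (Tat g) (comp2_heq (lax_comp_at _) (lwhiskerA _ _ _))) _.
  rewrite -[in l_at _ _ • _]comp2A Gl !comp2A -(lwhisker_comp2 _ (l_at _ _)).
  rewrite Fl !lwhisker_comp2 nat_G; exact: heq_refl.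
- apply: heq_eq; apply: heq_trans
    (comp2_heq (c_at_heq eg) (comp2_heq (Tat g) (lax_comp_at _))) _.
  apply: heq_sym; apply: heq_trans
    (comp2_heq (Tat g) (comp2_heq (lax_comp_at _) (lwhiskerA _ _ _))) _.
  have nat_G' := nat_G _ (id2 _); rewrite !comp2_f1 in nat_G'.
  have Fc' := f_equal (fun b => lax1 G ◁ b) Fc.
  have Gc' := f_equal (fun b => b • (lax1 G ◁ (tT Y ◁ lax_at (lax2 F) g)) •
                                    (lax1 G ◁ lax_at (lax2 F) (tT X ∘ g))) Gc.
  move: Fc' Gc'; rewrite /= !lwhisker_comp2 !comp2A => Fc' Gc'.
  rewrite -nat_G -nat_G' Gc' Fc'; exact: heq_refl.
Qed.

End Composition.
Lemma lax_at_id1 X Y (F : LaxMorphism X Y) : lax_at (lax2 F) (id1 X) ≡ lax2 F.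
Proof. exact: heq_trans (lax_at_heq _ _) (rwhisker1 _). Qed.

Definition lax_comp X Y Z (G : LaxMorphism Y Z) (F : LaxMorphism X Y) :
  LaxMorphism X Z :=
  {| lax1 := lax1 G ∘ lax1 F; lax2 := lax_comp2 G F;
     lax_axioms := lax_comp_axioms G F |}.

Lemma lax_compA W X Y Z
  (H : LaxMorphism Y Z) (G : LaxMorphism X Y) (F : LaxMorphism W X) :
  lax_comp (lax_comp H G) F = lax_comp H (lax_comp G F).
Proof.
apply: lax_morphism_eq => /=; first exact: comp1A.
apply: heq_trans (lax_comp2E (lax_comp H G) F) _ => /=.
apply: heq_trans (comp2_heq (lax_comp_at _ _ _) (lwhiskerA _ _ _)) _.
rewrite comp2A -lwhisker_comp2; apply: heq_sym.
apply: heq_trans (lax_comp2E H (lax_comp G F)) _.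
by apply: comp2_heq (heq_refl _) (lwhisker_heq _ (lax_comp2E _ _)).
Qed.

Lemma lax_comp_1f X Y (F : LaxMorphism X Y) : lax_comp (lax_id Y) F = F.
Proof.
apply: lax_morphism_eq => /=; first exact: comp1_1f.
apply: heq_trans (lax_comp2E (lax_id Y) F) _.
apply: heq_trans (comp2_heq (lax_id_at _) (lwhisker1 _)) _.
by rewrite comp2_1f; apply: heq_refl.
Qed.

Lemma lax_comp_f1 X Y (F : LaxMorphism X Y) : lax_comp F (lax_id X) = F.
Proof.
apply: lax_morphism_eq => /=; first exact: comp1_f1.
apply: heq_trans (lax_comp2E F (lax_id X)) _.
apply: heq_trans (comp2_heq (b' := lax2 F) (a' := id2 _) (lax_at_id1 _) _) _.
  rewrite -lwhisker_id2; apply: lwhisker_heq => //; exact: cast2_heq.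
by rewrite comp2_f1; apply: heq_refl.
Qed.

Lemma tangent_id2_axiom X Y (F : LaxMorphism X Y) :
  (tT Y ◁ id2 (lax1 F)) • lax2 F = lax2 F • (id2 (lax1 F) ▷ tT X).
Proof. by rewrite lwhisker_id2 rwhisker_id2 comp2_1f comp2_f1. Qed.

Definition tangent_id2 X Y (F : LaxMorphism X Y) : TangentTwoCell F F :=
  {| cell_axiom := tangent_id2_axiom F |}.

Lemma tangent_comp2_axiom X Y (F G H : LaxMorphism X Y)
  (b : TangentTwoCell G H) (a : TangentTwoCell F G) :
  (tT Y ◁ (cell b • cell a)) • lax2 F = lax2 H • ((cell b • cell a) ▷ tT X).
Proof.
by rewrite lwhisker_comp2 rwhisker_comp2 comp2A cell_axiom -!comp2A cell_axiom.
Qed.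

Definition tangent_comp2 X Y (F G H : LaxMorphism X Y)
  (b : TangentTwoCell G H) (a : TangentTwoCell F G) : TangentTwoCell F H :=
  {| cell_axiom := tangent_comp2_axiom b a |}.

Lemma cell_at X Y (F G : LaxMorphism X Y) (a : TangentTwoCell F G)
  (A : K) (g : hom A X) :
  (tT Y ◁ (cell a ▷ g)) • lax_at (lax2 F) g =
  lax_at (lax2 G) g • (cell a ▷ (tT X ∘ g)).
Proof.
apply: heq_eq.
apply: heq_trans (comp2_heq (heq_sym (lrwhiskerA _ _ _)) (lax_at_heq _ _)) _.
rewrite -rwhisker_comp2 cell_axiom rwhisker_comp2.
exact: comp2_heq (heq_sym (lax_at_heq _ _)) (rwhiskerA _ _ _).
Qed.

Lemma tangent_lwhisker_axiom X Y Z (H : LaxMorphism Y Z)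
  (F G : LaxMorphism X Y) (a : TangentTwoCell F G) :
  (tT Z ◁ (lax1 H ◁ cell a)) • lax_comp2 H F =
  lax_comp2 H G • ((lax1 H ◁ cell a) ▷ tT X).
Proof.
apply: heq_eq.
apply: heq_trans (comp2_heq (heq_refl _) (lax_comp2E _ _)) _.
rewrite -comp2A -lax_at_lwhisker comp2A -lwhisker_comp2 cell_axiom.
rewrite lwhisker_comp2 -comp2A.
exact/heq_sym/comp2_heq/lrwhiskerA/lax_comp2E.
Qed.

Definition tangent_lwhisker X Y Z (H : LaxMorphism Y Z)
  (F G : LaxMorphism X Y) (a : TangentTwoCell F G) :
  TangentTwoCell (lax_comp H F) (lax_comp H G) :=
  @Build_TangentTwoCell _ _ _ (lax_comp H F) (lax_comp H G) _
    (tangent_lwhisker_axiom H a).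

Lemma tangent_rwhisker_axiom X Y Z (F G : LaxMorphism Y Z)
  (a : TangentTwoCell F G) (H : LaxMorphism X Y) :
  (tT Z ◁ (cell a ▷ lax1 H)) • lax_comp2 F H =
  lax_comp2 G H • ((cell a ▷ lax1 H) ▷ tT X).
Proof.
apply: heq_eq.
apply: heq_trans (comp2_heq (heq_refl _) (lax_comp2E _ _)) _.
rewrite -comp2A cell_at comp2A interchange -comp2A.
exact/heq_sym/comp2_heq/rwhiskerA/lax_comp2E.
Qed.

Definition tangent_rwhisker X Y Z (F G : LaxMorphism Y Z)
  (a : TangentTwoCell F G) (H : LaxMorphism X Y) :
  TangentTwoCell (lax_comp F H) (lax_comp G H) :=
  @Build_TangentTwoCell _ _ _ (lax_comp F H) (lax_comp G H) _
    (tangent_rwhisker_axiom a H).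

Definition Tng : TwoCategory.
Proof.
refine {|
  ob := Tangentad K; hom := @LaxMorphism K; hom2 := @TangentTwoCell K;
  id1 := lax_id; comp1 := lax_comp; id2 := tangent_id2; comp2 := tangent_comp2;
  lwhisker := tangent_lwhisker; rwhisker := tangent_rwhisker;
  comp1A := lax_compA; comp1_1f := lax_comp_1f; comp1_f1 := lax_comp_f1 |}.
- by move=> *; apply/tangent_cell_eq/comp2A.
- by move=> *; apply/tangent_cell_eq/comp2_1f.
- by move=> *; apply/tangent_cell_eq/comp2_f1.
- by move=> *; apply/tangent_cell_eq/lwhisker_id2.
- by move=> *; apply/tangent_cell_eq/lwhisker_comp2.
- by move=> *; apply/tangent_cell_eq/rwhisker_id2.
- by move=> *; apply/tangent_cell_eq/rwhisker_comp2.
- by move=> *; apply/tangent_cell_eq/interchange.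
- by move=> *; apply: tangent_cell_heq; rewrite ?lax_comp_1f //; apply: lwhisker1.
- by move=> *; apply: tangent_cell_heq; rewrite ?lax_comp_f1 //; apply: rwhisker1.
- by move=> *; apply: tangent_cell_heq; rewrite ?lax_compA //; apply: lwhiskerA.
- by move=> *; apply: tangent_cell_heq; rewrite ?lax_compA //; apply: rwhiskerA.
- by move=> *; apply: tangent_cell_heq; rewrite ?lax_compA //; apply: lrwhiskerA.
Defined.

End TangentTwoCategory.

Record TwoFunctor (K L : TwoCategory) := {
  fob :> K -> L;
  fhom : forall X Y : K, hom X Y -> hom (fob X) (fob Y);
  fhom2 : forall (X Y : K) (f g : hom X Y), hom2 f g -> hom2 (fhom f) (fhom g);
  fhom_id1 : forall X : K, fhom (id1 X) = id1 (fob X);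
  fhom_comp1 : forall (X Y Z : K) (g : hom Y Z) (f : hom X Y),
    fhom (g ∘ f) = fhom g ∘ fhom f;
  fhom2_id2 : forall (X Y : K) (f : hom X Y), fhom2 (id2 f) = id2 (fhom f);
  fhom2_comp2 : forall (X Y : K) (f g h : hom X Y) (b : hom2 g h) (a : hom2 f g),
    fhom2 (b • a) = fhom2 b • fhom2 a;
  fhom2_lwhisker : forall (X Y Z : K) (H : hom Y Z) (f g : hom X Y)
    (a : hom2 f g), fhom2 (H ◁ a) ≡ fhom H ◁ fhom2 a;
  fhom2_rwhisker : forall (X Y Z : K) (f g : hom Y Z) (a : hom2 f g)
    (H : hom X Y), fhom2 (a ▷ H) ≡ fhom2 a ▷ fhom H }.

Definition Forget (K : TwoCategory) : TwoFunctor (Tng K) K :=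
  @Build_TwoFunctor (Tng K) K (fun X => carrier X)
    (fun _ _ F => lax1 F) (fun _ _ _ _ a => cell a)
    (fun _ => erefl) (fun _ _ _ _ _ => erefl)
    (fun _ _ _ => erefl) (fun _ _ _ _ _ _ _ => erefl)
    (fun _ _ _ _ _ _ _ => heq_refl _) (fun _ _ _ _ _ _ _ => heq_refl _).

(* The functor K(Z, P) -> K(Z, X1) * K(Z, X2) induced by p1 and p2 is an
   isomorphism of categories for every Z, that is, bijective on objects and fully
   faithful. *)
Definition IsTwoProduct (K : TwoCategory) (X1 X2 P : K)
  (p1 : hom P X1) (p2 : hom P X2) : Prop :=
  forall Z : K,
    (forall (f1 : hom Z X1) (f2 : hom Z X2),
       exists! f : hom Z P, p1 ∘ f = f1 /\ p2 ∘ f = f2) /\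
    (forall (f g : hom Z P)
       (a1 : hom2 (p1 ∘ f) (p1 ∘ g)) (a2 : hom2 (p2 ∘ f) (p2 ∘ g)),
       exists! a : hom2 f g, p1 ◁ a = a1 /\ p2 ◁ a = a2).

Definition IsTwoProductOf (K : TwoCategory) (I : Type) (X : I -> K) (P : K)
  (p : forall i, hom P (X i)) : Prop :=
  forall Z : K,
    (forall f_ : forall i, hom Z (X i),
       exists! f : hom Z P, forall i, p i ∘ f = f_ i) /\
    (forall (f g : hom Z P) (a_ : forall i, hom2 (p i ∘ f) (p i ∘ g)),
       exists! a : hom2 f g, forall i, p i ◁ a = a_ i).

Definition HasBinaryTwoProducts (K : TwoCategory) : Prop :=
  forall X1 X2 : K,
    exists (P : K) (p1 : hom P X1) (p2 : hom P X2), IsTwoProduct p1 p2.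

Definition HasTwoProducts (K : TwoCategory) (I : Type) : Prop :=
  forall X : I -> K,
    exists (P : K) (p : forall i, hom P (X i)), IsTwoProductOf p.

Definition PreservesBinaryTwoProducts (K L : TwoCategory) (U : TwoFunctor K L) :
  Prop :=
  forall (X1 X2 P : K) (p1 : hom P X1) (p2 : hom P X2),
    IsTwoProduct p1 p2 -> IsTwoProduct (fhom U p1) (fhom U p2).

Definition PreservesTwoProducts (K L : TwoCategory) (U : TwoFunctor K L)
  (I : Type) : Prop :=
  forall (X : I -> K) (P : K) (p : forall i, hom P (X i)),
    IsTwoProductOf p -> IsTwoProductOf (fun i => fhom U (p i)).

(* The structural 1-cells and 2-cells of DP restrict along q to those of D. *)
Record LiesOver (K : TwoCategory) (P X : K) (q : hom P X)
  (DP : TangentData P) (D : TangentData X) : Prop := {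
  over_T : q ∘ tT DP = tT D ∘ q;
  over_T2 : q ∘ tT2 DP = tT2 D ∘ q;
  over_pr : forall i, q ◁ tpr DP i ≡ tpr D i ▷ q;
  over_p : q ◁ tp DP ≡ tp D ▷ q;
  over_z : q ◁ tz DP ≡ tz D ▷ q;
  over_s : q ◁ ts DP ≡ ts D ▷ q;
  over_l : q ◁ tl DP ≡ tl D ▷ q;
  over_c : q ◁ tc DP ≡ tc D ▷ q }.

(* DP = D1 x D2 on the 2-product P of X1 and X2: a 1-cell P -> P is the product
   of h1 and h2 when its composites with the projections p1 and p2 are h1 p1 and
   h2 p2, and similarly for 2-cells. By the universal property of P there is
   exactly one such DP. *)
Definition IsProductTangentData (K : TwoCategory) (X1 X2 P : K)
  (p1 : hom P X1) (p2 : hom P X2) (D1 : TangentData X1) (D2 : TangentData X2)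
  (DP : TangentData P) : Prop :=
  LiesOver p1 DP D1 /\ LiesOver p2 DP D2.

(* Main.v *)
Require Import Defs.
From mathcomp Require Import all_boot.
From Stdlib Require Import IndefiniteDescription.

Set Implicit Arguments.
Unset Strict Implicit.
Unset Printing Implicit Defensive.
Local Open Scope twocat_scope.

(** Everything is done for a family [X i] of tangentads with an arbitrary index
    type; the binary product is the case of the booleans.

    A 2-product [P] with projections [π i] identifies 2-cells into [P] with
    families of 2-cells into the [X i]. So the 1-cells and 2-cells of the
    product tangent structure are the unique ones restricting along each [π i]
    to those of [X i] ([product_tangent_data]), and an equation between pastings
    of structural 2-cells of [P] holds as soon as it does in each [X i], because
    restriction along a 1-cell is compatible with composition and whiskering
    ([restricts_heq]). The same principle makes squares and cones in
    [K(Z, P)] limits as soon as their components are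
    ([fibre_power_product], [pullback_product]).

    The limit axioms need more care. The component in [X i] of a diagram on [P]
    is a diagram on [X i] precomposed with [π i], so a limit on [X i] can be used
    only if it is pointwise. For the fibre powers of [p] and the vertical lift
    this is part of the axioms, but for the fibre powers of [T^m p] it is not.
    It follows from the symmetry: iterating [c] gives an invertible 2-cell
    [T^m T => T T^m] that turns [T^m p] into [p] precomposed with [T^m]
    ([iterated_flip]), and fibre powers of the latter are pointwise because
    those of [p] are ([tangent_power_iter_pointwise]).

    The projections are strict, the 2-cell of each being an identity, so that
    the 2-cell of a composite [π i F] is just [π i] applied to that of [F].
    Hence a lax morphism into [P], or a tangent 2-cell between two of these, is
    again a family of such ([tangentad_product]). Finally, if [K] has 2-products
    then every 2-product in [Tng K] is isomorphic to one of those constructed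
    here, whose underlying cone is a 2-product by construction; this gives the
    preservation by the forgetful 2-functor ([tangentad_product_underlying]). *)

(** * Choice for dependent families *)

Lemma choice_family (I : Type) (T : I -> Type) (Q : forall i, T i -> Prop) :
  (forall i, exists x, Q i x) -> exists x : forall i, T i, forall i, Q i (x i).
Proof.
move=> h.
exists (fun i => proj1_sig (constructive_indefinite_description _ (h i))) => i.
exact: proj2_sig.
Qed.

Lemma choice_family2 (I : Type) (T : I -> Type)
  (Q R : forall i, T i -> Prop) : (forall i, exists2 x, Q i x & R i x) ->
  exists2 x : forall i, T i, forall i, Q i (x i) & forall i, R i (x i).
Proof.
move=> h; have [i|x hx] := @choice_family I T (fun i x => Q i x /\ R i x) _.
  by have [x qx rx] := h i; exists x.
by exists x => i; case: (hx i).
Qed.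

(** * Identity, whiskered and invertible 2-cells *)

Section Cells.
Variable K : TwoCategory.
Implicit Types X Y Z W : K.

Lemma eq_heq X Y (f g : hom X Y) (a b : hom2 f g) : a = b -> a ≡ b.
Proof. by move=> ->; exact: heq_refl. Qed.

Lemma heq_src X Y (f g f' g' : hom X Y) (a : hom2 f g) (b : hom2 f' g') :
  a ≡ b -> f = f'.
Proof. by case. Qed.

Lemma heq_tgt X Y (f g f' g' : hom X Y) (a : hom2 f g) (b : hom2 f' g') :
  a ≡ b -> g = g'.
Proof. by case. Qed.

Lemma eq2_heq X Y (f g : hom X Y) (e : f = g) : eq2 e ≡ id2 f.
Proof. by case: g / e; exact: heq_refl. Qed.

Lemma id2_heq X Y (f g : hom X Y) : f = g -> id2 f ≡ id2 g.
Proof. by move=> ->; exact: heq_refl. Qed.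

Lemma comp2_idl_heq X Y (f g h k : hom X Y) (e : hom2 g h) (a : hom2 f g) :
  e ≡ id2 k -> e • a ≡ a.
Proof.
move=> he; have eg := heq_src he; have eh := heq_tgt he.
case: k / eh he eg => he eg; case: h / eg e he => e /heq_eq ->.
by rewrite comp2_1f; exact: heq_refl.
Qed.

Lemma comp2_idr_heq X Y (f g h k : hom X Y) (a : hom2 g h) (e : hom2 f g) :
  e ≡ id2 k -> a • e ≡ a.
Proof.
move=> he; have ef := heq_tgt he; have eg := heq_src he.
case: k / eg he ef => he eg; case: f / eg e he => e /heq_eq ->.
by rewrite comp2_f1; exact: heq_refl.
Qed.

Lemma comp2e_idl_heq X Y (f g g' h k : hom X Y) (eg : g = g') (e : hom2 g' h)
  (a : hom2 f g) : e ≡ id2 k -> comp2e e a eg ≡ a.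
Proof.
case: g' / eg e => e he; rewrite /comp2e /= comp2_1f; exact: comp2_idl_heq he.
Qed.

Lemma comp2e_idr_heq X Y (f g g' h k : hom X Y) (eg : g = g') (a : hom2 g' h)
  (e : hom2 f g) : e ≡ id2 k -> comp2e a e eg ≡ a.
Proof.
case: g' / eg a => a he; rewrite /comp2e /= comp2_1f; exact: comp2_idr_heq he.
Qed.

Lemma lwhisker_id_heq X Y Z (H : hom Y Z) (f g k : hom X Y) (e : hom2 f g) :
  e ≡ id2 k -> H ◁ e ≡ id2 (H ∘ k).
Proof. by move=> he; rewrite -lwhisker_id2; exact: lwhisker_heq. Qed.

Lemma rwhisker_id_heq X Y Z (H : hom X Y) (f g k : hom Y Z) (e : hom2 f g) :
  e ≡ id2 k -> e ▷ H ≡ id2 (k ∘ H).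
Proof. by move=> he; rewrite -rwhisker_id2; exact: rwhisker_heq. Qed.

Section Lwhisker.
Variables (X Y Z : K) (q : hom Y Z).

Lemma lwhisker_comp2_heq (f g h : hom X Y) (f' g' h' : hom X Z)
  (b : hom2 g h) (a : hom2 f g) (b' : hom2 g' h') (a' : hom2 f' g') :
  q ◁ b ≡ b' -> q ◁ a ≡ a' -> q ◁ (b • a) ≡ b' • a'.
Proof. by rewrite lwhisker_comp2; exact: comp2_heq. Qed.

Lemma lwhisker_comp2e_heq (f g g1 h : hom X Y) (f' g' g1' h' : hom X Z)
  (e : g = g1) (e' : g' = g1')
  (b : hom2 g1 h) (a : hom2 f g) (b' : hom2 g1' h') (a' : hom2 f' g') :
  q ◁ b ≡ b' -> q ◁ a ≡ a' -> q ◁ comp2e b a e ≡ comp2e b' a' e'.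
Proof. by rewrite lwhisker_comp2e; exact: comp2e_heq. Qed.

End Lwhisker.

Definition IsInverse2 X Y (f g : hom X Y) (c : hom2 f g) (d : hom2 g f) : Prop :=
  d • c = id2 f /\ c • d = id2 g.

Lemma inverse2_sym X Y (f g : hom X Y) (c : hom2 f g) (d : hom2 g f) :
  IsInverse2 c d -> IsInverse2 d c.
Proof. by case. Qed.

Lemma inverse2_lwhisker X Y Z (H : hom Y Z) (f g : hom X Y) (c : hom2 f g) d :
  IsInverse2 c d -> IsInverse2 (H ◁ c) (H ◁ d).
Proof. by case=> dc cd; split; rewrite -lwhisker_comp2 ?dc ?cd lwhisker_id2. Qed.

Lemma inverse2_rwhisker X Y Z (H : hom X Y) (f g : hom Y Z) (c : hom2 f g) d :
  IsInverse2 c d -> IsInverse2 (c ▷ H) (d ▷ H).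
Proof. by case=> dc cd; split; rewrite -rwhisker_comp2 ?dc ?cd rwhisker_id2. Qed.

Lemma inverse2_cast2 X Y (f g f' g' : hom X Y) (ef : f = f') (eg : g = g')
  (c : hom2 f g) d : IsInverse2 c d -> IsInverse2 (cast2 ef eg c) (cast2 eg ef d).
Proof. by case: f' / ef; case: g' / eg. Qed.

Lemma inverse2_comp2e X Y (f g g' h : hom X Y) (e : g = g')
  (b : hom2 g' h) b' (a : hom2 f g) a' : IsInverse2 b b' -> IsInverse2 a a' ->
  IsInverse2 (comp2e b a e) (comp2e a' b' (esym e)).
Proof.
case: g' / e b b' => b b' [b'b bb'] [a'a aa']; rewrite /comp2e /= !comp2_1f.
split.
  by rewrite -comp2A (comp2A a') b'b comp2_f1 a'a.
by rewrite -comp2A (comp2A b) aa' comp2_f1 bb'.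
Qed.

End Cells.

(** * 2-products *)

Section TwoProduct.
Variables (K : TwoCategory) (I : Type) (X : I -> K) (P : K).
Variable π : forall i, hom P (X i).

Lemma two_product_intro :
  (forall Z (f_ : forall i, hom Z (X i)), exists f, forall i, π i ∘ f = f_ i) ->
  (forall Z (f g : hom Z P), (forall i, π i ∘ f = π i ∘ g) -> f = g) ->
  (forall Z (f g : hom Z P) (a_ : forall i, hom2 (π i ∘ f) (π i ∘ g)),
     exists a : hom2 f g, forall i, π i ◁ a = a_ i) ->
  (forall Z (f g : hom Z P) (a b : hom2 f g),
     (forall i, π i ◁ a = π i ◁ b) -> a = b) ->
  IsTwoProductOf π.
Proof.
move=> ex_hom hom_inj ex_cell cell_inj Z; split=> [f_ | f g a_].
  have [f hf] := ex_hom Z f_; exists f; split=> // g hg.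
  by apply: hom_inj => i; rewrite hf hg.
have [a ha] := ex_cell Z f g a_; exists a; split=> // b hb.
by apply: cell_inj => i; rewrite ha hb.
Qed.

Hypothesis prod : IsTwoProductOf π.

Lemma product_hom Z (f_ : forall i, hom Z (X i)) :
  exists f, forall i, π i ∘ f = f_ i.
Proof. by have [/(_ f_) [f [hf _]] _] := prod Z; exists f. Qed.

Lemma product_hom_inj Z (f g : hom Z P) : (forall i, π i ∘ f = π i ∘ g) -> f = g.
Proof.
move=> e; have [/(_ (fun i => π i ∘ f)) [h [_ uh]] _] := prod Z.
by rewrite -(uh f) // -(uh g).
Qed.

(** The sources and targets of the components are free, because the composites
    with [π i] that arise later are only propositionally equal to the expected
    1-cells. *)
Lemma product_cell Z (f g : hom Z P) (u v : forall i, hom Z (X i))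
  (a_ : forall i, hom2 (u i) (v i)) :
  (forall i, π i ∘ f = u i) -> (forall i, π i ∘ g = v i) ->
  exists a : hom2 f g, forall i, π i ◁ a ≡ a_ i.
Proof.
move=> eu ev; have [_ h] := prod Z.
have [a [ha _]] := h f g (fun i => cast2 (esym (eu i)) (esym (ev i)) (a_ i)).
by exists a => i; rewrite ha; exact: cast2_heq.
Qed.

Lemma product_cell_inj Z (f g f' g' : hom Z P) (a : hom2 f g) (b : hom2 f' g') :
  (forall i, π i ◁ a ≡ π i ◁ b) -> a ≡ b.
Proof.
move=> e.
have ef : f = f' by apply: product_hom_inj => i; exact: heq_src (e i).
have eg : g = g' by apply: product_hom_inj => i; exact: heq_tgt (e i).
case: f' / ef b e => b; case: g' / eg b => b e.
have [_ /(_ f g (fun i => π i ◁ a)) [h [_ uh]]] := prod Z.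
by rewrite -(uh a) // -(uh b) => [|i]; [exact: heq_refl | exact/esym/heq_eq].
Qed.

End TwoProduct.

(** * Fibre powers and pullbacks of 2-cells *)

Section FibrePowers.
Variable K : TwoCategory.

Section Hom.
Variables X Y : K.

Lemma fibre_power_heq (f g f' g' A A' : hom X Y) (p : hom2 f g) (p' : hom2 f' g')
  n (q : 'I_n -> hom2 A f) (q' : 'I_n -> hom2 A' f') :
  p ≡ p' -> A = A' -> (forall k, q k ≡ q' k) ->
  IsFibrePower p q -> IsFibrePower p' q'.
Proof.
move=> hp eA; case: A' / eA q'; case: f' g' p' / hp => q' /(_ _)/heq_eq eq.
case=> h1 h2; split=> [i j|B b /h2 [u [hu uniq]]]; first by rewrite -!eq.
exists u; split=> [i|v hv]; first by rewrite -eq.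
by apply: uniq => i; rewrite eq.
Qed.

Lemma pullback_heq (A B C P A' B' C' P' : hom X Y) (f : hom2 A C) (g : hom2 B C)
  (p1 : hom2 P A) (p2 : hom2 P B) (f' : hom2 A' C') (g' : hom2 B' C')
  (p1' : hom2 P' A') (p2' : hom2 P' B') :
  f ≡ f' -> g ≡ g' -> p1 ≡ p1' -> p2 ≡ p2' ->
  IsPullback f g p1 p2 -> IsPullback f' g' p1' p2'.
Proof.
move=> hf hg h1 h2.
case: A' C' f' / hf p1' g' hg h1 => p1' g' hg h1.
have eB := heq_src hg; case: B' / eB g' hg p2' h2 => g' /heq_eq <- p2' h2.
by have eP := heq_src h1; case: P' / eP p1' h1 p2' h2 => p1' /heq_eq <- p2' /heq_eq <-.
Qed.

Lemma fibre_power_iso_base (f f' g A : hom X Y) (p : hom2 f g) (p' : hom2 f' g)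
  (c : hom2 f f') (d : hom2 f' f) n (q : 'I_n -> hom2 A f) :
  IsInverse2 c d -> p' • c = p -> IsFibrePower p q ->
  IsFibrePower p' (fun k => c • q k).
Proof.
case=> dc cd e [h1 h2]; split=> [i j|B b hb]; first by rewrite -!comp2A e.
have e' : p • d = p' by rewrite -e comp2A cd comp2_f1.
have [|u [hu uniq]] := h2 B (fun k => d • b k).
  by move=> i j; rewrite -!comp2A e'.
exists u; split=> [i|v hv]; first by rewrite comp2A hu -comp2A cd comp2_1f.
by apply: uniq => i; rewrite -hv comp2A -comp2A dc comp2_1f.
Qed.

Lemma fibre_power_iso_apex (f g A A' : hom X Y) (p : hom2 f g)
  (t : hom2 A' A) (t' : hom2 A A') n (q : 'I_n -> hom2 A f) :
  IsInverse2 t t' -> IsFibrePower p q -> IsFibrePower p (fun k => q k • t).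
Proof.
case=> t't tt' [h1 h2]; split=> [i j|B b /h2 [u [hu uniq]]].
  by rewrite -!comp2A (h1 i j).
exists (t' • u); split=> [i|v hv].
  by rewrite comp2A -(comp2A t) tt' comp2_1f hu.
rewrite (uniq (t • v)) => [|i]; first by rewrite -comp2A t't comp2_1f.
by rewrite -comp2A.
Qed.

Lemma fibre_power_comparison (f g A A' : hom X Y) (p : hom2 f g) n
  (q : 'I_n -> hom2 A f) (q' : 'I_n -> hom2 A' f) :
  IsFibrePower p q -> IsFibrePower p q' ->
  exists (t : hom2 A' A) (t' : hom2 A A'),
    IsInverse2 t t' /\ forall k, q k • t = q' k.
Proof.
move=> [h1 h2] [h1' h2'].
have [t [ht _]] := h2 _ _ h1'; have [t' [ht' _]] := h2' _ _ h1.
exists t, t'; split=> //; split.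
  have [w [_ uw]] := h2' _ _ h1'; rewrite -(uw (id2 A')) ?(uw (t' • t)) // => i.
    by rewrite -comp2A ht'.
  by rewrite comp2_f1.
have [w [_ uw]] := h2 _ _ h1; rewrite -(uw (id2 A)) ?(uw (t • t')) // => i.
  by rewrite -comp2A ht.
by rewrite comp2_f1.
Qed.

End Hom.

(** Being pointwise does not depend on the choice of the limit cone: the
    comparison with another cone is invertible and stays so after
    precomposition. *)
Lemma fibre_power_pointwise (X Y : K) (f g A A' : hom X Y) (p : hom2 f g) n
  (q : 'I_n -> hom2 A f) (q' : 'I_n -> hom2 A' f) :
  IsPointwiseFibrePower p q -> IsFibrePower p q' -> IsPointwiseFibrePower p q'.
Proof.
move=> [hq pq] hq'; split=> // W F.
have [t [t' [tt' e]]] := fibre_power_comparison hq hq'.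
apply: fibre_power_heq (fibre_power_iso_apex (inverse2_rwhisker F tt') (pq W F)).
- exact: heq_refl.
- by [].
by move=> k; rewrite -rwhisker_comp2 e; exact: heq_refl.
Qed.

Section Joint.
Variables (I : Type) (X : I -> K) (P : K) (π : forall i, hom P (X i)).
Hypothesis prod : IsTwoProductOf π.
Variable Z : K.

(** Since [K(Z, P)] is the product of the categories [K(Z, X i)], limits in it
    are computed componentwise. *)
Lemma fibre_power_product (f g A : hom Z P) (p : hom2 f g) n
  (q : 'I_n -> hom2 A f) :
  (forall i, IsFibrePower (π i ◁ p) (fun k => π i ◁ q k)) -> IsFibrePower p q.
Proof.
move=> h; split=> [j k|B b hb].
  apply: heq_eq; apply: (product_cell_inj prod) => i; rewrite !lwhisker_comp2.
  by rewrite ((h i).1 j k); exact: heq_refl.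
have [i j k|u_ hu] := @choice_family I _ _
    (fun i => (h i).2 (π i ∘ B) (fun k => π i ◁ b k) _).
  by rewrite -!lwhisker_comp2 (hb j k).
have [//|//|u eu] := product_cell prod (f := B) (g := A) u_.
exists u; split=> [k|v hv].
  apply: heq_eq; apply: (product_cell_inj prod) => i; rewrite lwhisker_comp2.
  by rewrite (heq_eq (eu i)) (hu i).1; exact: heq_refl.
apply: heq_eq; apply: (product_cell_inj prod) => i.
rewrite (heq_eq (eu i)) ((hu i).2 (π i ◁ v)) => [|k]; first exact: heq_refl.
by rewrite -lwhisker_comp2 hv.
Qed.

Lemma pullback_product (A B C Q : hom Z P) (f : hom2 A C) (g : hom2 B C)
  (p1 : hom2 Q A) (p2 : hom2 Q B) :
  (forall i, IsPullback (π i ◁ f) (π i ◁ g) (π i ◁ p1) (π i ◁ p2)) ->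
  IsPullback f g p1 p2.
Proof.
move=> h; split=> [|R r1 r2 hr].
  apply: heq_eq; apply: (product_cell_inj prod) => i; rewrite !lwhisker_comp2.
  by rewrite (h i).1; exact: heq_refl.
have [i|u_ hu] := @choice_family I _ _
    (fun i => (h i).2 (π i ∘ R) (π i ◁ r1) (π i ◁ r2) _).
  by rewrite -!lwhisker_comp2 hr.
have [//|//|u eu] := product_cell prod (f := R) (g := Q) u_.
exists u; split=> [|v [hv1 hv2]].
  split; apply: heq_eq; apply: (product_cell_inj prod) => i; rewrite lwhisker_comp2;
    by rewrite (heq_eq (eu i)) ?(hu i).1.1 ?(hu i).1.2; exact: heq_refl.
apply: heq_eq; apply: (product_cell_inj prod) => i.
rewrite (heq_eq (eu i)) ((hu i).2 (π i ◁ v)); first exact: heq_refl.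
by rewrite -!lwhisker_comp2 hv1 hv2.
Qed.

End Joint.
End FibrePowers.

(** * Fibre powers of the iterated tangent projection *)

Section PowersOfT.
Variables (K : TwoCategory) (X : K) (D : TangentData X).
Hypothesis ax : IsTangentStructure D.
Let T := tT D.

(** The 2-cell [c] exchanges the two projections [T p] and [p T] of [T T]; moving
    one copy of [T] past [m] others by successive flips therefore exchanges
    [T^m p] with [p T^m]. *)
Lemma iterated_flip m : exists (c : hom2 (iter1 T m ∘ T) (T ∘ iter1 T m)) d,
  IsInverse2 c d /\ (tp D ▷ iter1 T m) • c ≡ iter1 T m ◁ tp D.
Proof.
elim: m => [|m [c [d [cd pc]]]] /=.
  have e : id1 X ∘ T = T ∘ id1 X by rewrite comp1_1f comp1_f1.
  exists (cast2 erefl e (id2 _)), (cast2 e erefl (id2 _)).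
  split; first by apply: inverse2_cast2; split; rewrite comp2_1f.
  apply: heq_trans (comp2_idr_heq _ (cast2_heq _ _ _)) _.
  exact: heq_trans (rwhisker1 _) (heq_sym (lwhisker1 _)).
set Tm := iter1 T m in c d cd pc *.
have e0 : T ∘ (Tm ∘ T) = T ∘ Tm ∘ T by rewrite comp1A.
have e1 : T ∘ (T ∘ Tm) = T ∘ T ∘ Tm by rewrite comp1A.
have e2 : T ∘ T ∘ Tm = T ∘ (T ∘ Tm) by rewrite comp1A.
have cc : IsInverse2 (tc D) (tc D) by split; apply: tangent_cc.
exists (cast2 e0 e2 (comp2e (tc D ▷ Tm) (T ◁ c) e1)),
       (cast2 e2 e0 (comp2e (T ◁ d) (tc D ▷ Tm) (esym e1))).
split.
  apply: inverse2_cast2; apply: inverse2_comp2e.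
    exact: inverse2_rwhisker.
  exact: inverse2_lwhisker.
(* The flip c T^m, with its source and target bracketed to the right. *)
pose b := cast2 (esym e1) e2 (tc D ▷ Tm).
have pb : (tp D ▷ (T ∘ Tm)) • b ≡ T ◁ (tp D ▷ Tm).
  apply: heq_trans (comp2_heq (heq_sym (rwhiskerA _ _ _)) (cast2_heq _ _ _)) _.
  rewrite -rwhisker_comp2.
  apply: heq_trans (rwhisker_heq erefl (tangent_pTc ax)) _.
  exact: lrwhiskerA.
apply: (heq_trans (b := (tp D ▷ (T ∘ Tm)) • b • (T ◁ c))).
  apply: comp2_heq (heq_refl _) (heq_trans (cast2_heq _ _ _) _).
  exact: comp2e_comp2 (heq_sym (cast2_heq _ _ _)) (heq_refl _).
rewrite -comp2A; apply: heq_trans (comp2_heq pb (heq_refl _)) _.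
rewrite -lwhisker_comp2.
exact: heq_trans (lwhisker_heq erefl pc) (heq_sym (lwhiskerA _ _ _)).
Qed.

(** The axioms make the whiskered cone [T^m q] a fibre power, but not a pointwise
    one. Through the iterated flip it is a fibre power of [p T^m], for which the
    cone [q T^m] is a pointwise fibre power because [q] is. *)
Lemma tangent_power_iter_pointwise n (A : hom X X) (q : 'I_n -> hom2 A T) m :
  IsTangentPower (tp D) q ->
  IsPointwiseFibrePower (iter1 T m ◁ tp D) (fun k => iter1 T m ◁ q k).
Proof.
move=> [[_ pq] hq]; split=> // W F; set Tm := iter1 T m.
have [c [d [cd pc]]] := iterated_flip m; rewrite -/Tm in c d cd pc.
pose p' := cast2 erefl (heq_tgt pc) (tp D ▷ Tm).
have hp : p' ≡ tp D ▷ Tm by exact: cast2_heq.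
have p'c : p' • c = Tm ◁ tp D.
  exact/heq_eq/(heq_trans (comp2_heq hp (heq_refl c))).
have pw : IsPointwiseFibrePower p' (fun k => q k ▷ Tm).
  split=> [|V G]; first by apply: fibre_power_heq (pq _ Tm) => //; exact: heq_sym.
  apply: fibre_power_heq (pq _ (Tm ∘ G)).
  - by apply: heq_trans (heq_sym (rwhiskerA _ _ _)) (rwhisker_heq erefl (heq_sym hp)).
  - by rewrite comp1A.
  by move=> k; exact/heq_sym/rwhiskerA.
have [_ /(_ W F) fp] := fibre_power_pointwise pw (fibre_power_iso_base cd p'c (hq m)).
have dF := inverse2_sym (inverse2_rwhisker F cd).
apply: fibre_power_heq (fibre_power_iso_base dF _ fp).
- exact: heq_refl.
- by [].
- move=> k; rewrite rwhisker_comp2 -comp2A dF.2 comp2_1f; exact: heq_refl.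
by rewrite -rwhisker_comp2 -p'c comp2A cd.2 comp2_f1.
Qed.

End PowersOfT.

(** * Restriction of 2-cells along a 1-cell *)

Section Restriction.
Variables (K : TwoCategory) (P X : K) (q : hom P X).

Lemma lwhisker_lwhisker_heq (Z : K) (T : hom P P) (T' : hom X X) (f g : hom Z P)
  (f' g' : hom Z X) (a : hom2 f g) (a' : hom2 f' g') : q ∘ T = T' ∘ q ->
  q ◁ a ≡ a' -> q ◁ (T ◁ a) ≡ T' ◁ a'.
Proof.
move=> eT ha; apply: heq_trans (heq_sym (lwhiskerA _ _ _)) _.
apply: heq_trans (lwhisker_heq eT (heq_refl _)) _.
exact: heq_trans (lwhiskerA _ _ _) (lwhisker_heq erefl ha).
Qed.

Lemma lwhisker_rwhisker_heq (W Z : K) (G : hom W Z) (f g : hom Z P)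
  (f' g' : hom Z X) (a : hom2 f g) (a' : hom2 f' g') :
  q ◁ a ≡ a' -> q ◁ (a ▷ G) ≡ a' ▷ G.
Proof.
by move=> ha; exact: heq_trans (heq_sym (lrwhiskerA _ _ _)) (rwhisker_heq erefl ha).
Qed.

(** The relation that [LiesOver] imposes on each pair of structural 2-cells. *)
Definition RestrictsTo (U V : hom P P) (U' V' : hom X X)
  (a : hom2 U V) (a' : hom2 U' V') : Prop := q ◁ a ≡ a' ▷ q.

Lemma restricts_comp2 (U V W : hom P P) (U' V' W' : hom X X)
  (b : hom2 V W) (a : hom2 U V) (b' : hom2 V' W') (a' : hom2 U' V') :
  RestrictsTo b b' -> RestrictsTo a a' -> RestrictsTo (b • a) (b' • a').
Proof. by rewrite /RestrictsTo rwhisker_comp2; exact: lwhisker_comp2_heq. Qed.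

Lemma restricts_comp2e (U V V1 W : hom P P) (U' V' V1' W' : hom X X)
  (e : V = V1) (e' : V' = V1') (b : hom2 V1 W) (a : hom2 U V)
  (b' : hom2 V1' W') (a' : hom2 U' V') :
  RestrictsTo b b' -> RestrictsTo a a' ->
  RestrictsTo (comp2e b a e) (comp2e b' a' e').
Proof. by rewrite /RestrictsTo rwhisker_comp2e; exact: lwhisker_comp2e_heq. Qed.

Lemma restricts_lwhisker (T U V : hom P P) (T' U' V' : hom X X)
  (a : hom2 U V) (a' : hom2 U' V') : q ∘ T = T' ∘ q ->
  RestrictsTo a a' -> RestrictsTo (T ◁ a) (T' ◁ a').
Proof.
move=> eT ha; apply: heq_trans (lwhisker_lwhisker_heq eT ha) _.
exact/heq_sym/lrwhiskerA.
Qed.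

Lemma restricts_at (Z : K) (U V : hom P P) (U' V' : hom X X)
  (a : hom2 U V) (a' : hom2 U' V') (f : hom Z P) (f' : hom Z X) :
  q ∘ f = f' -> RestrictsTo a a' -> q ◁ (a ▷ f) ≡ a' ▷ f'.
Proof.
move=> <- ha; exact: heq_trans (lwhisker_rwhisker_heq _ ha) (rwhiskerA _ _ _).
Qed.

Lemma restricts_rwhisker (T U V : hom P P) (T' U' V' : hom X X)
  (a : hom2 U V) (a' : hom2 U' V') : q ∘ T = T' ∘ q ->
  RestrictsTo a a' -> RestrictsTo (a ▷ T) (a' ▷ T').
Proof.
move=> eT ha; apply: heq_trans (restricts_at eT ha) (heq_sym (rwhiskerA _ _ _)).
Qed.

Lemma restricts_id2 (T : hom P P) (T' : hom X X) : q ∘ T = T' ∘ q ->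
  RestrictsTo (id2 T) (id2 T').
Proof.
by move=> eT; rewrite /RestrictsTo lwhisker_id2 rwhisker_id2; exact: id2_heq.
Qed.

Lemma restricts_eq2 (T U : hom P P) (T' U' : hom X X) (e : T = U) (e' : T' = U') :
  q ∘ T = T' ∘ q -> RestrictsTo (eq2 e) (eq2 e').
Proof. by case: U / e; case: U' / e'; exact: restricts_id2. Qed.

Lemma restricts_comp1 (T U : hom P P) (T' U' : hom X X) :
  q ∘ T = T' ∘ q -> q ∘ U = U' ∘ q -> q ∘ (T ∘ U) = T' ∘ U' ∘ q.
Proof. by move=> eT eU; rewrite -comp1A eT !comp1A eU. Qed.

Lemma restricts_id1 : q ∘ id1 P = id1 X ∘ q.
Proof. by rewrite comp1_1f comp1_f1. Qed.

Lemma restricts_iter1 (T : hom P P) (T' : hom X X) m : q ∘ T = T' ∘ q ->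
  q ∘ iter1 T m = iter1 T' m ∘ q.
Proof.
move=> eT; elim: m => [|m IHm] /=; first exact: restricts_id1.
exact: restricts_comp1.
Qed.

End Restriction.

(** * Lifting families of 2-cells to the product *)

Section Lifting.
Variables (K : TwoCategory) (I : Type) (X : I -> K) (P : K).
Variable π : forall i, hom P (X i).
Hypothesis prod : IsTwoProductOf π.

Lemma lift_hom (h : forall i, hom (X i) (X i)) :
  exists H : hom P P, forall i, π i ∘ H = h i ∘ π i.
Proof. exact: (product_hom prod). Qed.

Lemma lift_cell (U V : hom P P) (u v : forall i, hom (X i) (X i))
  (a_ : forall i, hom2 (u i) (v i)) :
  (forall i, π i ∘ U = u i ∘ π i) -> (forall i, π i ∘ V = v i ∘ π i) ->
  exists a : hom2 U V, forall i, RestrictsTo (π i) a (a_ i).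
Proof. by move=> eu ev; exact: (product_cell prod (fun i => a_ i ▷ π i) eu ev). Qed.

(** The principle by which the equational axioms pass to the product: pastings
    of 2-cells that restrict to equal pastings are equal. *)
Lemma restricts_heq (U V U1 V1 : hom P P) (u v u1 v1 : forall i, hom (X i) (X i))
  (a : hom2 U V) (b : hom2 U1 V1) (a_ : forall i, hom2 (u i) (v i))
  (b_ : forall i, hom2 (u1 i) (v1 i)) :
  (forall i, RestrictsTo (π i) a (a_ i)) -> (forall i, RestrictsTo (π i) b (b_ i)) ->
  (forall i, a_ i ≡ b_ i) -> a ≡ b.
Proof.
move=> ha hb e; apply: (product_cell_inj prod) => i.
apply: heq_trans (ha i) _.
exact: heq_trans (rwhisker_heq erefl (e i)) (heq_sym (hb i)).
Qed.

Lemma restricts_eq (U V : hom P P) (u v : forall i, hom (X i) (X i))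
  (a b : hom2 U V) (a_ b_ : forall i, hom2 (u i) (v i)) :
  (forall i, RestrictsTo (π i) a (a_ i)) -> (forall i, RestrictsTo (π i) b (b_ i)) ->
  (forall i, a_ i = b_ i) -> a = b.
Proof.
move=> ha hb e; apply/heq_eq/(restricts_heq ha hb) => i; exact: eq_heq.
Qed.

Lemma restricts_pairing (A B C : hom P P) (q : 'I_2 -> hom2 A C) (a b : hom2 B C)
  (u : hom2 B A) (A' B' C' : forall i, hom (X i) (X i))
  (q_ : forall i, 'I_2 -> hom2 (A' i) (C' i)) (a_ b_ : forall i, hom2 (B' i) (C' i))
  (u_ : forall i, hom2 (B' i) (A' i)) :
  (forall k i, RestrictsTo (π i) (q k) (q_ i k)) ->
  (forall i, RestrictsTo (π i) a (a_ i)) -> (forall i, RestrictsTo (π i) b (b_ i)) ->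
  (forall i, RestrictsTo (π i) u (u_ i)) ->
  (forall i, IsPairing (q_ i) (a_ i) (b_ i) (u_ i)) -> IsPairing q a b u.
Proof.
move=> hq ha hb hu h; split.
  by apply: restricts_eq (ha) _ => i; [exact: restricts_comp2 | case: (h i)].
by apply: restricts_eq (hb) _ => i; [exact: restricts_comp2 | case: (h i)].
Qed.

Lemma product_tangent_data (D : forall i, TangentData (X i)) :
  exists TT : TangentData P, forall i, LiesOver (π i) TT (D i).
Proof.
have [T hT] := lift_hom (fun i => tT (D i)).
have [T2 hT2] := lift_hom (fun i => tT2 (D i)).
have hTT i := restricts_comp1 (hT i) (hT i).
have h1 i := restricts_id1 (π i).
have [pr hpr] := choice_family
  (fun k : 'I_2 => lift_cell (fun i => tpr (D i) k) hT2 hT).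
have [p hp] := lift_cell (fun i => tp (D i)) hT h1.
have [z hz] := lift_cell (fun i => tz (D i)) h1 hT.
have [s hs] := lift_cell (fun i => ts (D i)) hT2 hT.
have [l hl] := lift_cell (fun i => tl (D i)) hT hTT.
have [c hc] := lift_cell (fun i => tc (D i)) hTT hTT.
exists (Build_TangentData pr p z s l c) => i.
by split=> [||k|||||] /=; [exact: hT | exact: hT2 | exact: hpr | exact: hp |
  exact: hz | exact: hs | exact: hl | exact: hc].
Qed.

End Lifting.

(** * The tangent structure of the product *)

Section ProductTangentStructure.
Variables (K : TwoCategory) (I : Type) (X : I -> K) (P : K).
Variable π : forall i, hom P (X i).
Hypothesis prod : IsTwoProductOf π.
Variables (D : forall i, TangentData (X i)) (TT : TangentData P).
Hypothesis ax : forall i, IsTangentStructure (D i).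
Hypothesis over : forall i, LiesOver (π i) TT (D i).

Let oT i : π i ∘ tT TT = tT (D i) ∘ π i. Proof. exact: over_T. Qed.
Let oT2 i : π i ∘ tT2 TT = tT2 (D i) ∘ π i. Proof. exact: over_T2. Qed.
Let oTT i : π i ∘ (tT TT ∘ tT TT) = tT (D i) ∘ tT (D i) ∘ π i.
Proof. exact: restricts_comp1. Qed.
Let opr k i : RestrictsTo (π i) (tpr TT k) (tpr (D i) k).
Proof. exact: over_pr. Qed.
Let op i : RestrictsTo (π i) (tp TT) (tp (D i)). Proof. exact: over_p. Qed.
Let oz i : RestrictsTo (π i) (tz TT) (tz (D i)). Proof. exact: over_z. Qed.
Let os i : RestrictsTo (π i) (ts TT) (ts (D i)). Proof. exact: over_s. Qed.
Let ol i : RestrictsTo (π i) (tl TT) (tl (D i)). Proof. exact: over_l. Qed.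
Let oc i : RestrictsTo (π i) (tc TT) (tc (D i)). Proof. exact: over_c. Qed.

(* With these rules a goal [RestrictsTo a _] is solved by following the way in
   which [a] is pasted from structural 2-cells. *)
Local Hint Resolve restricts_comp2 restricts_comp2e restricts_lwhisker
  restricts_rwhisker restricts_id2 restricts_eq2 restricts_id1 restricts_comp1
  oT oT2 oTT opr op oz os ol oc : over.

Ltac over := intros; eauto 12 with over.

(** The components of the cone [T^m q] are the cones [T^m (q_ i)] precomposed with
    [π i], so the pointwise form of the preservation by [T^m] is needed. *)
Lemma product_tangent_power n (A_ : forall i, hom (X i) (X i))
  (q_ : forall i, 'I_n -> hom2 (A_ i) (tT (D i))) (A : hom P P)
  (q : 'I_n -> hom2 A (tT TT)) :
  (forall i, π i ∘ A = A_ i ∘ π i) ->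
  (forall k i, RestrictsTo (π i) (q k) (q_ i k)) ->
  (forall i, IsTangentPower (tp (D i)) (q_ i)) -> IsTangentPower (tp TT) q.
Proof.
move=> hA hq h; split; first split.
- apply: (fibre_power_product prod) => i.
  apply: fibre_power_heq ((h i).1.2 _ (π i)).
  + exact/heq_sym/op.
  + exact/esym/hA.
  by move=> k; exact/heq_sym/hq.
- move=> W F; apply: (fibre_power_product prod) => i.
  apply: fibre_power_heq ((h i).1.2 _ (π i ∘ F)).
  + exact/heq_sym/restricts_at.
  + by rewrite -!comp1A hA.
  by move=> k; exact/heq_sym/restricts_at.
move=> m; apply: (fibre_power_product prod) => i.
have om := restricts_iter1 m (oT i).
apply: fibre_power_heq ((tangent_power_iter_pointwise (ax i) m (h i)).2 _ (π i)).
+ exact/heq_sym/restricts_lwhisker.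
+ by rewrite comp1A -hA -!comp1A om.
by move=> k; exact/heq_sym/restricts_lwhisker.
Qed.

Lemma product_has_tangent_powers n : (1 <= n)%N ->
  exists (A_ : forall i, hom (X i) (X i))
    (q_ : forall i, 'I_n -> hom2 (A_ i) (tT (D i)))
    (A : hom P P) (q : 'I_n -> hom2 A (tT TT)),
    [/\ forall i, IsTangentPower (tp (D i)) (q_ i),
        forall i, π i ∘ A = A_ i ∘ π i
      & forall k i, RestrictsTo (π i) (q k) (q_ i k)].
Proof.
move=> n1; have [A_ /choice_family [q_ hq_]] :=
  choice_family (fun i => tangent_power (ax i) n1).
have [A hA] := lift_hom prod A_.
have [q hq] := choice_family
  (fun k : 'I_n => lift_cell prod (fun i => q_ i k) hA oT).
by exists A_, q_, A, q.
Qed.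

(** An axiom about an induced 2-cell [<a, b>] asserts that some [u] is that 2-cell
    and has a further property [Q]; both conditions are lifted at once. *)
Lemma lift_pairing (A B C : hom P P) (q : 'I_2 -> hom2 A C) (a b : hom2 B C)
  (A' B' C' : forall i, hom (X i) (X i))
  (q_ : forall i, 'I_2 -> hom2 (A' i) (C' i)) (a_ b_ : forall i, hom2 (B' i) (C' i))
  (Q : hom2 B A -> Prop) (Q_ : forall i, hom2 (B' i) (A' i) -> Prop) :
  (forall i, exists2 u, IsPairing (q_ i) (a_ i) (b_ i) u & Q_ i u) ->
  (forall k i, RestrictsTo (π i) (q k) (q_ i k)) ->
  (forall i, π i ∘ A = A' i ∘ π i) -> (forall i, π i ∘ B = B' i ∘ π i) ->
  (forall i, RestrictsTo (π i) a (a_ i)) -> (forall i, RestrictsTo (π i) b (b_ i)) ->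
  (forall u u_, (forall i, RestrictsTo (π i) u (u_ i)) -> (forall i, Q_ i (u_ i)) ->
     Q u) ->
  exists2 u, IsPairing q a b u & Q u.
Proof.
move=> h hq hA hB ha hb hQ.
have [u_ hu_ Qu_] := choice_family2 h.
have [u hu] := lift_cell prod u_ hB hA.
exists u; last exact: hQ hu Qu_.
exact: restricts_pairing hq ha hb hu hu_.
Qed.

(** Associativity of the addition is known for the threefold fibre power [A] that
    lifts chosen ones of the [X i]; any other cone [q] factors through [A]. *)
Lemma product_addition_assoc (T3 : hom P P) (q : 'I_3 -> hom2 T3 (tT TT)) :
  IsFibrePower (tp TT) q ->
  let q1 := q ord0 in let q2 := q (@Ordinal 3 1 isT) in let q3 := q ord_max in
  exists u12 u23 v w,
    [/\ IsPairing (tpr TT) q1 q2 u12, IsPairing (tpr TT) q2 q3 u23,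
        IsPairing (tpr TT) (ts TT • u12) q3 v, IsPairing (tpr TT) q1 (ts TT • u23) w
      & ts TT • v = ts TT • w].
Proof.
move=> hq /=.
have [A_ [r_ [A [r [hr_ hA hr]]]]] := product_has_tangent_powers (isT : 1 <= 3)%N.
have hr3 := (product_tangent_power hA hr hr_).1.1.
have [u12_ h] := choice_family
  (fun i => tangent_sA (ax i) (hr_ i).1.1).
have {h}[u23_ h] := choice_family h.
have {h}[v_ h] := choice_family h.
have {h}[w_ h] := choice_family h.
have [u12 h12] := lift_cell prod u12_ hA oT2.
have [u23 h23] := lift_cell prod u23_ hA oT2.
have [v hv] := lift_cell prod v_ hA oT2.
have [w hw] := lift_cell prod w_ hA oT2.
have h1 i := let: And5 x _ _ _ _ := h i in x.
have h2 i := let: And5 _ x _ _ _ := h i in x.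
have h3 i := let: And5 _ _ x _ _ := h i in x.
have h4 i := let: And5 _ _ _ x _ := h i in x.
have h5 i := let: And5 _ _ _ _ x := h i in x.
have [t [ht _]] := hr3.2 _ _ hq.1.
have pair_t (a b : hom2 A (tT TT)) x : IsPairing (tpr TT) a b x ->
    IsPairing (tpr TT) (a • t) (b • t) (x • t).
  by case=> <- <-; split; rewrite comp2A.
exists (u12 • t), (u23 • t), (v • t), (w • t); split; rewrite -?ht -?comp2A.
- by apply: pair_t; apply: (restricts_pairing prod _ _ _ _ h1); over.
- by apply: pair_t; apply: (restricts_pairing prod _ _ _ _ h2); over.
- by apply: pair_t; apply: (restricts_pairing prod _ _ _ _ h3); over.
- by apply: pair_t; apply: (restricts_pairing prod _ _ _ _ h4); over.
by congr (_ • t); apply: (restricts_eq prod) h5; over.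
Qed.

Lemma product_is_tangent_structure : IsTangentStructure TT.
Proof.
split.
- exact: product_tangent_power oT2 opr (fun i => tangent_power2 (ax i)).
- move=> n /product_has_tangent_powers [A_ [q_ [A [q [hq_ hA hq]]]]].
  by exists A, q; exact: product_tangent_power hA hq hq_.
- by apply: (restricts_eq prod) (fun i => tangent_pz (ax i)); over.
- by apply: (restricts_eq prod) (fun i => tangent_ps (ax i)); over.
- exact: product_addition_assoc.
- apply: (lift_pairing (fun i => tangent_sC (ax i))); [over..|].
  by move=> u u_ hu; apply: (restricts_eq prod); over.
- apply: (lift_pairing (fun i => tangent_s1 (ax i))); [over..|].
  by move=> u u_ hu; apply: (restricts_eq prod); over.
- by apply: (restricts_heq prod) (fun i => tangent_Tpl (ax i)); over.
- by apply: (restricts_heq prod) (fun i => tangent_lz (ax i)); over.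
- apply: (lift_pairing (fun i => tangent_ls (ax i))); [over..|].
  by move=> u u_ hu; apply: (restricts_eq prod); over.
- by apply: (restricts_heq prod) (fun i => tangent_pTc (ax i)); over.
- by apply: (restricts_heq prod) (fun i => tangent_cTz (ax i)); over.
- apply: (lift_pairing (fun i => tangent_cTs (ax i))); [over..|].
  by move=> u u_ hu; apply: (restricts_eq prod); over.
- by apply: (restricts_heq prod) (fun i => tangent_Tll (ax i)); over.
- by apply: (restricts_eq prod) (fun i => tangent_cl (ax i)); over.
- by apply: (restricts_heq prod) (fun i => tangent_cTcl (ax i)); over.
- by apply: (restricts_eq prod) (fun i => tangent_cc (ax i)); over.
- by apply: (restricts_heq prod) (fun i => tangent_ccc (ax i)); over.
- apply: (lift_pairing (fun i => tangent_vertical_lift (ax i))); [over..|].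
  move=> u u_ hu pb; split=> [|W F]; apply: (pullback_product prod) => i.
    by apply: pullback_heq ((pb i).2 _ (π i)); apply: heq_sym;
      rewrite -/(RestrictsTo _ _ _); over.
  apply: pullback_heq ((pb i).2 _ (π i ∘ F)); apply: heq_sym;
    apply: restricts_at; over.
Qed.

End ProductTangentStructure.

(** * The projections as strict tangent morphisms *)

Section StrictProjection.
Variables (K : TwoCategory) (X Y : Tangentad K) (q : hom Y X).
Hypothesis over : LiesOver q Y X.

Let a : hom2 (q ∘ tT Y) (tT X ∘ q) := eq2 (over_T over).

Lemma strict_lax_axioms : IsLaxTangent a.
Proof.
have ha : a ≡ id2 (q ∘ tT Y) := eq2_heq _.
have Ta := lwhisker_id_heq (tT X) ha.
have aT := rwhisker_id_heq (tT Y) ha.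
pose u : hom2 (q ∘ tT2 Y) (tT2 X ∘ q) := eq2 (over_T2 over).
have hu (r : hom2 (tT2 Y) (tT Y)) (r' : hom2 (tT2 X) (tT X)) :
    RestrictsTo q r r' -> (r' ▷ q) • u = a • (q ◁ r).
  move=> hr; apply: heq_eq.
  apply: heq_trans (comp2_idr_heq _ (eq2_heq _)) _.
  exact: heq_trans (heq_sym hr) (heq_sym (comp2_idl_heq _ ha)).
split.
- exact: heq_trans (comp2_idr_heq _ ha) (heq_sym (over_p over)).
- exact: heq_trans (comp2_idl_heq _ ha) (over_z over).
- exists u; first by split; apply/hu/over_pr.
  exact/esym/hu/over_s.
- apply: heq_trans (comp2_idr_heq _ ha) _; apply: heq_sym.
  apply: heq_trans (comp2e_idl_heq _ _ Ta) _.
  exact: heq_trans (comp2e_idl_heq _ _ aT) (over_l over).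
have Ta_aT e := heq_trans (comp2e_idl_heq e (a ▷ tT Y) Ta) aT.
apply: heq_trans (comp2e_idr_heq _ _ (Ta_aT _)) _; apply: heq_sym.
apply: heq_trans (comp2e_idl_heq _ _ Ta) _.
exact: heq_trans (comp2e_idl_heq _ _ aT) (over_c over).
Qed.

Definition strict_lax : LaxMorphism Y X := Build_LaxMorphism strict_lax_axioms.

Lemma strict_lax_strict : IsStrictTangent strict_lax.
Proof. exact: eq2_heq. Qed.

(** The 2-cell of a composite [q F] is [q] applied to the 2-cell of [F], pasted
    with an identity. *)
Lemma strict_lax_comp2 (Z : Tangentad K) (F : LaxMorphism Z Y) :
  q ◁ lax2 F ≡ lax_comp2 strict_lax F.
Proof.
apply: heq_sym; apply: heq_trans (lax_comp2E _ _) _; apply: comp2_idl_heq.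
exact: heq_trans (lax_at_heq _ _) (rwhisker_id_heq _ (eq2_heq _)).
Qed.

End StrictProjection.

(** * The universal property among tangentads *)

Section UniversalProperty.
Variables (K : TwoCategory) (I : Type) (X : I -> Tangentad K) (Y : Tangentad K).
Variable π : forall i, hom Y (X i).
Hypothesis prod : IsTwoProductOf π.
Hypothesis over : forall i, LiesOver (π i) Y (X i).

Section Tuple.
Variables (Z : Tangentad K) (F_ : forall i, LaxMorphism Z (X i)).
Variables (f : hom Z Y) (a : hom2 (f ∘ tT Z) (tT Y ∘ f)).
Hypothesis hf : forall i, π i ∘ f = lax1 (F_ i).
Hypothesis ha : forall i, π i ◁ a ≡ lax2 (F_ i).

Lemma tuple_lax_axioms : IsLaxTangent a.
Proof.
have fw i (U V : hom Z Z) (b : hom2 U V) : π i ◁ (f ◁ b) ≡ lax1 (F_ i) ◁ b.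
  exact: heq_trans (heq_sym (lwhiskerA _ _ _)) (lwhisker_heq (hf i) (heq_refl _)).
have rf i U V U' V' (b : hom2 U V) (b' : hom2 U' V') : RestrictsTo (π i) b b' ->
    π i ◁ (b ▷ f) ≡ b' ▷ lax1 (F_ i).
  exact: restricts_at.
have Ta i : π i ◁ (tT Y ◁ a) ≡ tT (X i) ◁ lax2 (F_ i).
  exact: lwhisker_lwhisker_heq (over_T (over i)) (ha i).
have aT i : π i ◁ (a ▷ tT Z) ≡ lax2 (F_ i) ▷ tT Z.
  exact: lwhisker_rwhisker_heq.
have ax i := lax_axioms (F_ i).
split.
- apply: (product_cell_inj prod) => i.
  apply: heq_trans (lwhisker_comp2_heq (rf _ _ _ _ _ _ _ (over_p (over i))) (ha i)) _.
  exact: heq_trans (lax_p (ax i)) (heq_sym (fw _ _ _ _)).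
- apply: (product_cell_inj prod) => i.
  apply: heq_trans (lwhisker_comp2_heq (ha i) (fw _ _ _ _)) _.
  exact: heq_trans (lax_z (ax i)) (heq_sym (rf _ _ _ _ _ _ _ (over_z (over i)))).
- have [u_ hu_ su_] := choice_family2 (fun i => lax_s (ax i)).
  have e0 i : π i ∘ (f ∘ tT2 Z) = lax1 (F_ i) ∘ tT2 Z by rewrite -comp1A hf.
  have e1 i : π i ∘ (tT2 Y ∘ f) = tT2 (X i) ∘ lax1 (F_ i).
    by rewrite -comp1A (over_T2 (over i)) comp1A hf.
  have [u hu] := product_cell prod u_ e0 e1.
  have E (r : hom2 (tT2 Z) (tT Z)) (s : hom2 (tT2 Y) (tT Y)) s_ :
      (forall i, RestrictsTo (π i) s (s_ i)) ->
      (forall i, (s_ i ▷ lax1 (F_ i)) • u_ i = lax2 (F_ i) • (lax1 (F_ i) ◁ r)) ->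
      (s ▷ f) • u = a • (f ◁ r).
    move=> hs e; apply/heq_eq/(product_cell_inj prod) => i.
    apply: heq_trans (lwhisker_comp2_heq (rf _ _ _ _ _ _ _ (hs i)) (hu i)) _.
    rewrite e; exact/heq_sym/lwhisker_comp2_heq.
  exists u; last by apply/esym/(E _ _ _ (fun i => over_s (over i))) => i.
  by split; apply: (E _ _ _ (fun i => over_pr (over i) _)) => i; case: (hu_ i).
- apply: (product_cell_inj prod) => i.
  apply: heq_trans (lwhisker_comp2_heq (rf _ _ _ _ _ _ _ (over_l (over i))) (ha i)) _.
  apply: heq_trans (lax_l (ax i)) _; apply: heq_sym.
  exact: lwhisker_comp2e_heq (Ta i) (lwhisker_comp2e_heq _ _ (aT i) (fw _ _ _ _)).
apply: (product_cell_inj prod) => i.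
apply: heq_trans (heq_trans _ (lax_c (ax i))) _; last apply: heq_sym.
  exact: lwhisker_comp2e_heq (rf _ _ _ _ _ _ _ (over_c (over i)))
    (lwhisker_comp2e_heq _ _ (Ta i) (aT i)).
exact: lwhisker_comp2e_heq (Ta i) (lwhisker_comp2e_heq _ _ (aT i) (fw _ _ _ _)).
Qed.

End Tuple.

Lemma eq_lax2 (Z W : Tangentad K) (F G : LaxMorphism Z W) : F = G -> lax2 F ≡ lax2 G.
Proof. by move=> ->; exact: heq_refl. Qed.

Lemma tangentad_product :
  IsTwoProductOf (K := Tng K) (X := X) (P := Y) (fun i => strict_lax (over i)).
Proof.
apply: two_product_intro => [Z F_|Z F G e|Z F G a_|Z F G a b e].
- have [f hf] := product_hom prod (fun i => lax1 (F_ i)).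
  have e0 i : π i ∘ (f ∘ tT Z) = lax1 (F_ i) ∘ tT Z by rewrite -comp1A hf.
  have e1 i : π i ∘ (tT Y ∘ f) = tT (X i) ∘ lax1 (F_ i).
    by rewrite -comp1A (over_T (over i)) comp1A hf.
  have [a ha] := product_cell prod (fun i => lax2 (F_ i)) e0 e1.
  pose F := Build_LaxMorphism (tuple_lax_axioms hf ha).
  exists F => i; apply: lax_morphism_eq; first exact: hf.
  exact: heq_trans (heq_sym (strict_lax_comp2 (over i) F)) (ha i).
- apply: lax_morphism_eq.
    by apply: (product_hom_inj prod) => i; exact: (f_equal (@lax1 _ _ _) (e i)).
  apply: (product_cell_inj prod) => i.
  apply: heq_trans (strict_lax_comp2 (over i) F) _.
  exact: heq_trans (eq_lax2 (e i)) (heq_sym (strict_lax_comp2 (over i) G)).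
- have [//|//|a ha] := product_cell prod (f := lax1 F) (g := lax1 G)
    (fun i => cell (a_ i)).
  suff ax : (tT Y ◁ a) • lax2 F = lax2 G • (a ▷ tT Z).
    exists (Build_TangentTwoCell ax) => i.
    exact/tangent_cell_eq/heq_eq/ha.
  apply/heq_eq/(product_cell_inj prod) => i.
  have Ta : π i ◁ (tT Y ◁ a) ≡ tT (X i) ◁ cell (a_ i).
    exact: lwhisker_lwhisker_heq (over_T (over i)) (ha i).
  have aT : π i ◁ (a ▷ tT Z) ≡ cell (a_ i) ▷ tT Z.
    exact: lwhisker_rwhisker_heq.
  apply: heq_trans (lwhisker_comp2_heq Ta (strict_lax_comp2 _ _)) _.
  apply: heq_trans (eq_heq (cell_axiom (a_ i))) _; apply: heq_sym.
  exact: lwhisker_comp2_heq (strict_lax_comp2 _ _) aT.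
apply/tangent_cell_eq/heq_eq/(product_cell_inj prod) => i.
exact: (eq_heq (f_equal (@cell _ _ _ _ _) (e i))).
Qed.

End UniversalProperty.

Lemma product_of_tangentads (K : TwoCategory) (I : Type) (X : I -> Tangentad K)
  (P : K) (π : forall i, hom P (X i)) : IsTwoProductOf π ->
  exists (TT : TangentData P) (ax : IsTangentStructure TT)
    (q : forall i, LaxMorphism (Build_Tangentad ax) (X i)),
    [/\ forall i, LiesOver (π i) TT (X i), forall i, lax1 (q i) = π i,
        IsTwoProductOf (K := Tng K) (P := Build_Tangentad ax) q
      & forall i, IsStrictTangent (q i)].
Proof.
move=> prod; have [TT over] := product_tangent_data prod (fun i => tdata (X i)).
have ax := product_is_tangent_structure prod (fun i => taxioms (X i)) over.
exists TT, ax, (fun i => @strict_lax _ (X i) (Build_Tangentad ax) _ (over i)).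
split=> // [|i]; last exact: strict_lax_strict.
exact: (@tangentad_product _ _ X (Build_Tangentad ax) _ prod over).
Qed.

(** * Preservation by the forgetful 2-functor *)

Section Transport.
Variables (K : TwoCategory) (I : Type) (X : I -> K).

Lemma two_product_iso (P Q : K) (p : forall i, hom P (X i))
  (q : forall i, hom Q (X i)) (u : hom P Q) (v : hom Q P) :
  IsTwoProductOf q -> (forall i, q i ∘ u = p i) ->
  v ∘ u = id1 P -> u ∘ v = id1 Q -> IsTwoProductOf p.
Proof.
move=> prod qu vu uv.
have qv i : p i ∘ v = q i by rewrite -qu comp1A uv comp1_f1.
have vuK Z (f : hom Z P) : v ∘ (u ∘ f) = f by rewrite -comp1A vu comp1_1f.
have vuK2 Z (f g : hom Z P) (a : hom2 f g) : v ◁ (u ◁ a) ≡ a.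
  apply: heq_trans (heq_sym (lwhiskerA _ _ _)) _.
  exact: heq_trans (lwhisker_heq vu (heq_refl _)) (lwhisker1 _).
have qu2 Z (f g : hom Z P) (a : hom2 f g) i : q i ◁ (u ◁ a) ≡ p i ◁ a.
  exact: heq_trans (heq_sym (lwhiskerA _ _ _)) (lwhisker_heq (qu i) (heq_refl _)).
apply: two_product_intro => [Z f_|Z f g e|Z f g a_|Z f g a b e].
- have [f hf] := product_hom prod f_; exists (v ∘ f) => i.
  by rewrite -comp1A qv.
- rewrite -(vuK _ f) -(vuK _ g); congr (v ∘ _); apply: (product_hom_inj prod) => i.
  by rewrite -!comp1A qu.
- have [i|i|b hb] := product_cell prod (f := u ∘ f) (g := u ∘ g) a_;
    try by rewrite -comp1A qu.
  exists (cast2 (vuK _ f) (vuK _ g) (v ◁ b)) => i; apply: heq_eq.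
  apply: heq_trans (lwhisker_heq erefl (cast2_heq _ _ _)) _.
  apply: heq_trans (heq_sym (lwhiskerA _ _ _)) _.
  exact: heq_trans (lwhisker_heq (qv i) (heq_refl _)) (hb i).
apply: heq_eq; apply: heq_trans (heq_sym (vuK2 _ _ _ a)) _.
apply: heq_trans (lwhisker_heq erefl _) (vuK2 _ _ _ b).
apply: (product_cell_inj prod) => i.
apply: heq_trans (qu2 _ _ _ _ _) _; rewrite e; exact/heq_sym/qu2.
Qed.

Lemma two_product_comparison (P Q : K) (p : forall i, hom P (X i))
  (q : forall i, hom Q (X i)) : IsTwoProductOf p -> IsTwoProductOf q ->
  exists (u : hom P Q) (v : hom Q P),
    [/\ forall i, q i ∘ u = p i, v ∘ u = id1 P & u ∘ v = id1 Q].
Proof.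
move=> hp hq; have [u hu] := product_hom hq p; have [v hv] := product_hom hp q.
exists u, v; split=> //.
  by apply: (product_hom_inj hp) => i; rewrite -comp1A hv hu comp1_f1.
by apply: (product_hom_inj hq) => i; rewrite -comp1A hu hv comp1_f1.
Qed.

End Transport.

(** The given product [p] in [Tng K] is compared with the one constructed on the
    product [π] of the underlying objects, whose projections have [π i] as
    underlying 1-cells. *)
Lemma tangentad_product_underlying (K : TwoCategory) (I : Type)
  (X : I -> Tangentad K) (P : K) (π : forall i, hom P (X i)) (Y : Tangentad K)
  (p : forall i, LaxMorphism Y (X i)) : IsTwoProductOf π ->
  IsTwoProductOf (K := Tng K) (P := Y) p -> IsTwoProductOf (fun i => lax1 (p i)).
Proof.
move=> hπ hp; have [TT [ax [q [_ eq hq _]]]] := product_of_tangentads hπ.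
have [u [v [qu vu uv]]] := two_product_comparison hp hq.
apply: (two_product_iso (u := lax1 u) (v := lax1 v) hπ).
- by move=> i; rewrite -eq -(f_equal (@lax1 _ _ _) (qu i)).
- exact: (f_equal (@lax1 K Y Y) vu).
exact: (f_equal (@lax1 K (Build_Tangentad ax) (Build_Tangentad ax)) uv).
Qed.

(** * Binary products *)

(** The return type depends on [b], so that a pair of projections with different
    targets is such a family. *)
Definition bool_family (T : bool -> Type) (x : T true) (y : T false) b : T b :=
  if b then x else y.

Lemma binary_two_productP (K : TwoCategory) (X : bool -> K) (P : K)
  (p : forall b, hom P (X b)) :
  IsTwoProduct (p true) (p false) <-> IsTwoProductOf p.
Proof.
split=> h; [apply: two_product_intro => [Z f_|Z f g e|Z f g a_|Z f g a b e] | move=> Z].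
- have [/(_ (f_ true) (f_ false)) [f [[e1 e2] _]] _] := h Z.
  by exists f; case.
- have [/(_ (p true ∘ f) (p false ∘ f)) [k [_ uk]] _] := h Z.
  by rewrite -(uk f) // -(uk g).
- have [_ /(_ f g (a_ true) (a_ false)) [a [[e1 e2] _]]] := h Z.
  by exists a; case.
- have [_ /(_ f g (p true ◁ a) (p false ◁ a)) [k [_ uk]]] := h Z.
  by rewrite -(uk a) // -(uk b).
split=> [f1 f2|f g a1 a2].
  have [f hf] := product_hom h (@bool_family (fun b => hom Z (X b)) f1 f2).
  exists f; split=> [|g [g1 g2]]; first by rewrite !hf.
  by apply: (product_hom_inj h) => -[]; rewrite hf.
have [//|//|a ha] := product_cell h (f := f) (g := g)
  (@bool_family (fun b => hom2 (p b ∘ f) (p b ∘ g)) a1 a2).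
have ha' b := heq_eq (ha b).
exists a; split=> [|b [b1 b2]]; first by rewrite !ha'.
by apply/heq_eq/(product_cell_inj h) => -[]; rewrite ha' /= ?b1 ?b2; exact: heq_refl.
Qed.

Lemma binary_product_of_tangentads (K : TwoCategory) (X X' : Tangentad K) (P : K)
  (p1 : hom P X) (p2 : hom P X') : IsTwoProduct p1 p2 ->
  exists (TT : TangentData P) (ax : IsTangentStructure TT),
    IsProductTangentData p1 p2 X X' TT /\
    let PT := Build_Tangentad ax in
    exists (q1 : LaxMorphism PT X) (q2 : LaxMorphism PT X'),
      [/\ lax1 q1 = p1 /\ lax1 q2 = p2,
          IsTwoProduct (K := Tng K) q1 q2,
          IsStrictTangent q1
        & IsStrictTangent q2].
Proof.
pose Xb := @bool_family (fun=> Tangentad K) X X'.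
pose p := @bool_family (fun b => hom P (Xb b)) p1 p2.
move=> /(@binary_two_productP K Xb P p)/product_of_tangentads.
case=> TT [ax [q [over q1 prod strict]]]; exists TT, ax.
split; first by split; [exact: (over true) | exact: (over false)].
exists (q true), (q false); split; [|exact/(@binary_two_productP (Tng K) Xb)| |] => //.
- by split; [exact: (q1 true) | exact: (q1 false)].
- exact: (strict true).
exact: (strict false).
Qed.

Theorem proposition4p1 (K : TwoCategory) :
  (forall (X X' : Tangentad K) (P : K) (p1 : hom P X) (p2 : hom P X'),
     IsTwoProduct p1 p2 ->
     exists (TT : TangentData P) (ax : IsTangentStructure TT),
       IsProductTangentData p1 p2 X X' TT /\
       let PT := Build_Tangentad ax in
       exists (q1 : LaxMorphism PT X) (q2 : LaxMorphism PT X'),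
         [/\ lax1 q1 = p1 /\ lax1 q2 = p2,
             IsTwoProduct (K := Tng K) q1 q2,
             IsStrictTangent q1
           & IsStrictTangent q2]) /\
  (HasBinaryTwoProducts K ->
     HasBinaryTwoProducts (Tng K) /\ PreservesBinaryTwoProducts (Forget K)) /\
  (forall I : Type, HasTwoProducts K I ->
     HasTwoProducts (Tng K) I /\ PreservesTwoProducts (Forget K) I).
Proof.
split; first exact: binary_product_of_tangentads.
split=> [hasK|I hasK]; split.
- move=> X X'; have [P [p1 [p2 /binary_product_of_tangentads]]] := hasK X X'.
  case=> TT [ax [_ [q1 [q2 [_ prod _ _]]]]].
  by exists (Build_Tangentad ax), q1, q2.
- move=> X X' Y q1 q2 h; have [P [p1 [p2 hP]]] := hasK X X'.
  pose Xb := @bool_family (fun=> Tangentad K) X X'.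
  pose p := @bool_family (fun b => hom P (Xb b)) p1 p2.
  pose q := @bool_family (fun b => LaxMorphism Y (Xb b)) q1 q2.
  apply/(@binary_two_productP K Xb _ (fun b => lax1 (q b))).
  apply: (@tangentad_product_underlying _ _ Xb _ p).
    exact/(@binary_two_productP K Xb P p).
  exact/(@binary_two_productP (Tng K) Xb Y q).
- move=> X; have [P [p /product_of_tangentads [TT [ax [q [_ _ prod _]]]]]] := hasK X.
  by exists (Build_Tangentad ax), q.
move=> X Y q h; have [P [p hP]] := hasK X.
exact: tangentad_product_underlying hP h.
Qed.
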